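(* Let $X$ be a locally compact Hausdorff space, $\mathcal C$ a $C_0(X)$-category, and $\{\pi_x:\mathcal C\to\mathcal C_x\}_{x\in X}$ the set of fibre functors of $\mathcal C$. For all objects $\rho,\sigma$ of $\mathcal C$ and every $t\in(\rho,\sigma)$, the norm function $n_t(x):=\|\pi_x(t)\|$, $x\in X$, is upper semicontinuous and vanishing at infinity; moreover, $\|t\|=\sup_{x\in X}\|\pi_x(t)\|$.
   Context: A $C^*$-category $\mathcal C$ is a category, not necessarily with identity arrows, in which every set of arrows $(\rho,\sigma)$ (arrows from $\rho$ to $\sigma$) is a complex Banach space, composition $(t',t)\mapsto t'\circ t$ is bilinear with $\|t'\circ t\|\le\|t'\|\|t\|$, together with an antilinear isometric involutive contravariant functor $*$ which is the identity on objects, such that $\|t^*\circ t\|=\|t\|^2$ and $t^*\circ t$ is positive in the $C^*$-algebra $(\rho,\rho)$ for every $t\in(\rho,\sigma)$. $M(\rho,\rho)$ denotes the multiplier algebra of the $C^*$-algebra $(\rho,\rho)$. For $t\in(\rho,\sigma)$, $A\in M(\rho,\rho)$, $B\in M(\sigma,\sigma)$ put $tA:=\lim_\lambda t\circ(e^\rho_\lambda A)$ and $Bt:=\lim_\lambda(Be^\sigma_\lambda)\circ t$, where $(e^\rho_\lambda)$, $(e^\sigma_\lambda)$ are approximate units of $(\rho,\rho)$, $(\sigma,\sigma)$ (the limits exist in norm in $(\rho,\sigma)$). $\mathcal C$ is a $C_0(X)$-category if for every object $\rho$ there is given a non-degenerate $C^*$-morphism $i_\rho:C_0(X)\to M(\rho,\rho)$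 such that $t\,i_\rho(f)=i_\sigma(f)\,t$ for all objects $\rho,\sigma$, $t\in(\rho,\sigma)$, $f\in C_0(X)$; one writes $ft=tf$ for this element. For $x\in X$ let $C_x(X)\subset C_0(X)$ be the ideal of functions vanishing at $x$. The fibre $\mathcal C_x$ is the $C^*$-category with the same objects as $\mathcal C$ and arrows the quotient Banach spaces $(\rho,\sigma)_x:=(\rho,\sigma)/[C_x(X)(\rho,\sigma)]$, where $C_x(X)(\rho,\sigma)$ is the (closed) span of $\{ft: f\in C_x(X),t\in(\rho,\sigma)\}$; the fibre functor $\pi_x:\mathcal C\to\mathcal C_x$ is the identity on objects and the quotient map on arrows. *)

(* Defs.v *)
From HB Require Import structures.
From mathcomp Require Import all_boot all_order all_algebra.
From mathcomp Require Import complex.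
From mathcomp Require Import all_classical all_reals all_analysis.

Set Implicit Arguments.
Unset Strict Implicit.
Unset Printing Implicit Defensive.

Import Order.TTheory GRing.Theory Num.Theory.
Import numFieldNormedType.Exports.

Local Open Scope classical_set_scope.
Local Open Scope ring_scope.
Local Open Scope complex_scope.
Local Open Scope quotient_scope.

HB.instance Definition _ (R : realType) := NormedModule.copy R[i] (R[i]^o).

(* Norms over R[i] take (real, nonnegative) values in R[i]. *)
Definition rnorm (R : realType) (V : normedModType R[i]) (v : V) : R :=
  complex.Re `|v|.

Definition upper_semicontinuous (X : topologicalType) (R : realType)
    (f : X -> R) : Prop :=
  forall (x : X) (a : R), f x < a -> \forall y \near x, f y < a.

Definition vanishes_at_infinity (X : topologicalType) (K : numFieldType)
    (V : normedZmodType K) (f : X -> V) : Prop :=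
  forall e : K, 0 < e ->
    exists2 A : set X, compact A & forall x, ~ A x -> `|f x| < e.

Definition linear_span (K : numFieldType) (V : normedModType K) (S : set V) :
    set V :=
  [set v | exists n (c : 'I_n -> K) (u : 'I_n -> V),
     (forall i, S (u i)) /\ v = \sum_(i < n) c i *: u i].

Section ComplexNorm.
Variables (R : realType) (V : normedModType R[i]).
Implicit Types u v : V.

Lemma rnormE v : `|v| = (rnorm v)%:C.
Proof. by rewrite RRe_real// normr_real. Qed.

Lemma rnorm_ge0 v : 0 <= rnorm v.
Proof. by have := normr_ge0 v; rewrite rnormE -[0]/(0%:C) lecR. Qed.

Lemma ler_rnormD u v : rnorm (u + v) <= rnorm u + rnorm v.
Proof. by have := ler_normD u v; rewrite !rnormE -rmorphD lecR. Qed.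

End ComplexNorm.

(** The algebra C_0(X) *)

Section C0.
Variables (R : realType) (X : topologicalType).

Definition C0_pred : {pred (X -> R[i])} :=
  fun f => `[< continuous f /\ vanishes_at_infinity f >].

Lemma C0_predP (f : X -> R[i]) :
  reflect (continuous f /\ vanishes_at_infinity f) (f \in C0_pred).
Proof. exact: asboolP. Qed.

Lemma C0_submod_closed : submod_closed C0_pred.
Proof.
split=> [|a f g /C0_predP[cf vf] /C0_predP[cg vg]]; apply/C0_predP; split.
- by move=> x; exact: cvg_cst.
- move=> e e0; exists set0; first exact: compact0.
  by move=> x _; rewrite normr0.
- move=> x; apply: cvgD; last exact: cg.
  by apply: cvgZr; exact: cf.
- move=> e e0.
  have a0 : 0 < `|a| + 1 by rewrite ltr_wpDl.
  have e2 : 0 < e / 2 by rewrite divr_gt0.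
  have [A cA hA] := vf _ (divr_gt0 e2 a0).
  have [B cB hB] := vg _ e2.
  exists (A `|` B) => [|x /not_orP[nA nB]]; first exact: compactU.
  rewrite (le_lt_trans (ler_normD _ _))// (splitr e) ler_ltD//; last exact: hB.
  rewrite normrM (@le_trans _ _ ((`|a| + 1) * `|f x|))//.
    by rewrite ler_wpM2r// lerDl.
  by rewrite mulrC -ler_pdivlMr// ltW// hA.
Qed.
HB.instance Definition _ := GRing.isSubmodClosed.Build _ _ C0_pred
  C0_submod_closed.

Record C0 := MkC0 { C0_fun :> X -> R[i]; C0_funP : C0_fun \in C0_pred }.
HB.instance Definition _ := [isSub for C0_fun].
HB.instance Definition _ := [Choice of C0 by <:].
HB.instance Definition _ := [SubChoice_isSubLmodule of C0 by <:].

Lemma C0_mul_subproof (f g : C0) : (fun x => f x * g x) \in C0_pred.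
Proof.
have /C0_predP[cf vf] := C0_funP f; have /C0_predP[cg vg] := C0_funP g.
apply/C0_predP; split=> [x|e e0].
  by apply: cvgM; [exact: cf|exact: cg].
have [A cA hA] := vf _ e0; have [B cB hB] := vg _ ltr01.
exists (A `|` B) => [|x /not_orP[nA nB]]; first exact: compactU.
rewrite normrM -[e]mulr1 ltr_pM//; first exact: hA.
exact: hB.
Qed.
Definition C0_mul (f g : C0) : C0 := MkC0 (C0_mul_subproof f g).

Lemma C0_conj_subproof (f : C0) : (fun x => conjc (f x)) \in C0_pred.
Proof.
have /C0_predP[cf vf] := C0_funP f.
apply/C0_predP; split=> [x|e e0].
  apply/cvgrPdist_lt => e e0.
  have /cvgrPdist_lt/(_ _ e0) := cf x.
  by apply: filterS => y; rewrite -rmorphB normcJ.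
have [A cA hA] := vf _ e0; exists A => // x nA.
by rewrite normcJ hA.
Qed.
Definition C0_conj (f : C0) : C0 := MkC0 (C0_conj_subproof f).

Definition C0_vanishing_at (x : X) : set C0 := [set f | f x = 0].

End C0.
Arguments C0 : clear implicits.

(** Quotient of a normed space by a closed subspace *)

Record closedSubspace (R : realType) (V : normedModType R[i]) := ClosedSubspace {
  cs_set : set V;
  cs0 : cs_set 0;
  cs_linear : forall (k : R[i]) u v, cs_set u -> cs_set v -> cs_set (k *: u + v);
  cs_closed : closed cs_set
}.

Section Quotient.
Variables (R : realType) (V : normedModType R[i]) (N : closedSubspace V).

Definition cs_pred : {pred V} := fun v => `[< cs_set N v >].

Lemma cs_zmod_closed : zmod_closed cs_pred.
Proof.
split=> [|u v /asboolP Nu /asboolP Nv]; apply/asboolP; first exact: cs0.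
by rewrite addrC -scaleN1r; exact: cs_linear.
Qed.
HB.instance Definition _ := GRing.isZmodClosed.Build V cs_pred cs_zmod_closed.

Definition quotient_space : Type := Quotient.quot cs_pred.
Local Notation Q := quotient_space.
HB.instance Definition _ := GRing.Zmodule.on Q.

Definition quotient_map (v : V) : Q := \pi_(Quotient.quot cs_pred) v.

Lemma quotient_mapD u v : quotient_map (u + v) = quotient_map u + quotient_map v.
Proof. exact: (raddfD (\pi_(Quotient.quot cs_pred))). Qed.

Lemma quotient_map_eq0 v : quotient_map v = 0 <-> cs_set N v.
Proof.
have -> : (0 : Q) = quotient_map 0 by rewrite /quotient_map raddf0.
split=> [/eqP|Nv]; last apply/eqP.
  by rewrite /quotient_map -Quotient.idealrBE subr0 => /asboolP.
by rewrite /quotient_map -Quotient.idealrBE subr0; exact/asboolP.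
Qed.

Lemma quotient_mapP (q : Q) : exists v, quotient_map v = q.
Proof. by exists (repr q); rewrite /quotient_map reprK. Qed.

Definition quotient_scale (k : R[i]) (q : Q) : Q := quotient_map (k *: repr q).

Lemma quotient_mapZ k v : quotient_map (k *: v) = quotient_scale k (quotient_map v).
Proof.
apply/eqP; rewrite /quotient_scale /quotient_map -Quotient.idealrBE -scalerBr.
apply/asboolP; rewrite -[_ *: _]addr0; apply: cs_linear; last exact: cs0.
by apply/asboolP; rewrite -[`[< _ >]]/(_ \in cs_pred) Quotient.idealrBE reprK.
Qed.

Lemma quotient_scaleA a b q :
  quotient_scale a (quotient_scale b q) = quotient_scale (a * b) q.
Proof.
by have [v <-] := quotient_mapP q; rewrite -!quotient_mapZ scalerA.
Qed.

Lemma quotient_scale1 : left_id 1 quotient_scale.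
Proof. by move=> q; have [v <-] := quotient_mapP q; rewrite -quotient_mapZ scale1r. Qed.

Lemma quotient_scaleDr : right_distributive quotient_scale +%R.
Proof.
move=> k p q; have [u <-] := quotient_mapP p; have [v <-] := quotient_mapP q.
by rewrite -quotient_mapD -!quotient_mapZ -quotient_mapD scalerDr.
Qed.

Lemma quotient_scaleDl q : {morph quotient_scale^~ q : a b / a + b}.
Proof.
move=> a b; have [v <-] := quotient_mapP q.
by rewrite -!quotient_mapZ -quotient_mapD scalerDl.
Qed.

HB.instance Definition _ := GRing.Zmodule_isLmodule.Build R[i] Q
  quotient_scaleA quotient_scale1 quotient_scaleDr quotient_scaleDl.

Lemma quotient_map_linear : linear quotient_map.
Proof. by move=> k u v; rewrite quotient_mapD quotient_mapZ. Qed.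
HB.instance Definition _ := GRing.isLinear.Build R[i] V Q *:%R quotient_map
  quotient_map_linear.

Definition quotient_rnorm (q : Q) : R :=
  inf [set rnorm v | v in [set v | quotient_map v = q]].

Definition quotient_norm (q : Q) : R[i] := (quotient_rnorm q)%:C.

Let norms q := [set rnorm v | v in [set v | quotient_map v = q]].

Let norms_has_inf q : has_inf (norms q).
Proof.
split; last by exists 0 => _ [v _ <-]; exact: rnorm_ge0.
by have [v vq] := quotient_mapP q; exists (rnorm v), v.
Qed.

Let quotient_rnorm_le v : quotient_rnorm (quotient_map v) <= rnorm v.
Proof. by apply: ge_inf; [case: (norms_has_inf (quotient_map v))|exists v]. Qed.

Let quotient_rnorm_lift q e : quotient_rnorm q < e ->
  exists2 v, quotient_map v = q & rnorm v < e.
Proof. by move=> /(inf_lt (norms_has_inf q).1)[_ [v vq <-] ve]; exists v. Qed.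

Let quotient_rnorm_ge0 q : 0 <= quotient_rnorm q.
Proof.
by apply: lb_le_inf; [case: (norms_has_inf q)|move=> _ [v _ <-]; exact: rnorm_ge0].
Qed.

Let quotient_normD p q :
  quotient_norm (p + q) <= quotient_norm p + quotient_norm q.
Proof.
rewrite /quotient_norm -rmorphD lecR; apply/ler_addgt0Pr => e e0.
have e2 : 0 < e / 2 by rewrite divr_gt0.
have [u <- ue] : exists2 u, quotient_map u = p & rnorm u < quotient_rnorm p + e / 2.
  by apply: quotient_rnorm_lift; rewrite ltrDl.
have [v <- ve] : exists2 v, quotient_map v = q & rnorm v < quotient_rnorm q + e / 2.
  by apply: quotient_rnorm_lift; rewrite ltrDl.
rewrite -quotient_mapD (le_trans (quotient_rnorm_le _))//.
rewrite (le_trans (ler_rnormD _ _))// (le_trans (ltW (ltrD ue ve)))//.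
by rewrite addrACA -splitr.
Qed.

Let quotient_rnormZ_le k q :
  quotient_rnorm (k *: q) <= complex.Re `|k| * quotient_rnorm q.
Proof.
have rnormZ v : rnorm (k *: v) = complex.Re `|k| * rnorm v.
  by apply: complexI; rewrite rmorphM/= -!rnormE normrZ -(rnormE (k : R[i])).
have := rnorm_ge0 (k : R[i]); rewrite /rnorm le_eqVlt => /predU1P[k0|k_gt0].
  have [v <-] := quotient_mapP q; rewrite -linearZ -k0 mul0r.
  by rewrite (le_trans (quotient_rnorm_le _))// rnormZ -k0 mul0r.
rewrite leNgt; apply/negP; rewrite mulrC -ltr_pdivlMr// => /quotient_rnorm_lift[v].
move=> <-; rewrite ltr_pdivlMr// mulrC -rnormZ -linearZ ltNge.
by rewrite quotient_rnorm_le.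
Qed.

Let quotient_normZ k q : quotient_norm (k *: q) = `|k| * quotient_norm q.
Proof.
rewrite (rnormE (k : R[i])) -rmorphM; congr (_%:C); apply/eqP.
rewrite eq_le quotient_rnormZ_le/=; have [->|k0] := eqVneq k 0.
  by rewrite /rnorm normr0 mul0r.
have kn0 : 0 < rnorm (k : R[i]) by rewrite -ltcR -rnormE normr_gt0.
rewrite mulrC -ler_pdivlMr// mulrC.
have := quotient_rnormZ_le k^-1 (k *: q).
rewrite scalerA mulVf// scale1r normfV (rnormE (k : R[i])).
by rewrite -fmorphV.
Qed.

Let quotient_norm0 q : quotient_norm q = 0 -> q = 0.
Proof.
move=> /complexI q0; have [v vq] := quotient_mapP q.
rewrite -vq; apply/quotient_map_eq0/cs_closed => B /nbhs_ballP[e/= e0 veB].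
have [u uq ue] : exists2 u, quotient_map u = q & rnorm u < complex.Re e.
  by apply: quotient_rnorm_lift; rewrite q0; move: e0; rewrite ltcE => /andP[].
exists (v - u); split.
  by apply/quotient_map_eq0; rewrite linearB/= vq uq subrr.
apply: veB; rewrite -ball_normE/= opprB addrC subrK rnormE.
by rewrite -[e]RRe_real ?ltcR// gtr0_real.
Qed.

HB.instance Definition _ := Lmodule_isNormed.Build R[i] Q
  quotient_normD quotient_normZ quotient_norm0.

Lemma quotient_normE (v : V) : `|quotient_map v| =
  (inf [set rnorm u | u in [set u | quotient_map u = quotient_map v]])%:C.
Proof. by []. Qed.

End Quotient.

Section ClosedSpan.
Variables (R : realType) (V : normedModType R[i]) (S : set V).

Let span0 : closure (linear_span S) 0.
Proof.
apply: subset_closure; exists 0, (fun=> 0), (fun=> 0).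
by split=> [[]|]//; rewrite big_ord0.
Qed.

Let span_linear k u v : linear_span S u -> linear_span S v ->
  linear_span S (k *: u + v).
Proof.
move=> [n [a [x [Sx ->]]]] [m [b [y [Sy ->]]]]; exists (n + m)%N.
exists (fun i => match fintype.split i with inl j => k * a j | inr j => b j end).
exists (fun i => match fintype.split i with inl j => x j | inr j => y j end).
split=> [i|]; first by case: (fintype.split i).
rewrite big_split_ord/= scaler_sumr; congr (_ + _); apply: eq_bigr => i _.
  by rewrite (unsplitK (inl i)) scalerA.
by rewrite (unsplitK (inr i)).
Qed.

Let closure_linear k u v : closure (linear_span S) u ->
  closure (linear_span S) v -> closure (linear_span S) (k *: u + v).
Proof.
move=> cu cv B kuvB.
have : (fun p : V * V => k *: p.1 + p.2) @ (nbhs u, nbhs v) --> k *: u + v.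
  apply: (@cvgD _ _ _ _ _ (fun p : V * V => k *: p.1) snd); last exact: cvg_snd.
  by apply: cvgZr; exact: cvg_fst.
move=> /(_ _ kuvB)[[U W]/= [uU vW] UWB].
have [a [Sa Ua]] := cu _ uU; have [b [Sb Wb]] := cv _ vW.
by exists (k *: a + b); split; [exact: span_linear|exact: (UWB (a, b))].
Qed.

Definition closed_span : closedSubspace V :=
  ClosedSubspace span0 closure_linear (@closed_closure _ (linear_span S)).

End ClosedSpan.

(** C*-categories *)

(* No identity arrows are required.  An element of the C*-algebra arrow r r is
   positive when it is of the form s^* s. *)
Record CstarCategory (R : realType) := MkCstarCategory {
  cstar_obj :> Type;
  arrow : cstar_obj -> cstar_obj -> completeNormedModType R[i];
  acomp : forall r s u : cstar_obj, arrow s u -> arrow r s -> arrow r u;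
  astar : forall r s : cstar_obj, arrow r s -> arrow s r;
  acompA : forall (r s u v : cstar_obj) (a : arrow u v) (b : arrow s u) (c : arrow r s),
    acomp a (acomp b c) = acomp (acomp a b) c;
  acomp_linear_l : forall (r s u : cstar_obj) (t : arrow r s),
    linear (fun t' : arrow s u => acomp t' t);
  acomp_linear_r : forall (r s u : cstar_obj) (t' : arrow s u),
    linear (fun t : arrow r s => acomp t' t);
  acomp_norm : forall (r s u : cstar_obj) (t' : arrow s u) (t : arrow r s),
    `|acomp t' t| <= `|t'| * `|t|;
  astar_antilinear : forall (r s : cstar_obj) (a : R[i]) (t t' : arrow r s),
    astar (a *: t + t') = conjc a *: astar t + astar t';
  astar_norm : forall (r s : cstar_obj) (t : arrow r s), `|astar t| = `|t|;
  astarK : forall (r s : cstar_obj) (t : arrow r s), astar (astar t) = t;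
  astar_comp : forall (r s u : cstar_obj) (t' : arrow s u) (t : arrow r s),
    astar (acomp t' t) = acomp (astar t) (astar t');
  cstar_norm : forall (r s : cstar_obj) (t : arrow r s),
    `|acomp (astar t) t| = `|t| ^+ 2;
  cstar_pos : forall (r s : cstar_obj) (t : arrow r s),
    exists a : arrow r r, acomp (astar t) t = acomp (astar a) a
}.

Declare Scope cstar_scope.
Delimit Scope cstar_scope with cstar.
Local Open Scope cstar_scope.
Notation "a \oc b" := (acomp a b) (at level 40, left associativity) : cstar_scope.
Notation "a ^#" := (astar a) (at level 2, format "a ^#") : cstar_scope.

Section CstarTheory.
Variables (R : realType) (C : CstarCategory R).
Implicit Types r s u : C.

Lemma acompDl r s u (a b : arrow s u) (c : arrow r s) :
  (a + b) \oc c = a \oc c + b \oc c.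
Proof. by have := acomp_linear_l c 1 a b; rewrite !scale1r. Qed.

Lemma acompDr r s u (c : arrow s u) (a b : arrow r s) :
  c \oc (a + b) = c \oc a + c \oc b.
Proof. by have := acomp_linear_r c 1 a b; rewrite !scale1r. Qed.

Lemma acomp0l r s u (c : arrow r s) : (0 : arrow s u) \oc c = 0.
Proof. by apply: (@addrI _ (0 \oc c)); rewrite -acompDl !addr0. Qed.

Lemma acomp0r r s u (c : arrow s u) : c \oc (0 : arrow r s) = 0.
Proof. by apply: (@addrI _ (c \oc 0)); rewrite -acompDr !addr0. Qed.

Lemma acompZl r s u k (a : arrow s u) (c : arrow r s) :
  (k *: a) \oc c = k *: (a \oc c).
Proof. by have := acomp_linear_l c k a 0; rewrite !addr0 acomp0l addr0. Qed.

Lemma acompZr r s u k (c : arrow s u) (a : arrow r s) :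
  c \oc (k *: a) = k *: (c \oc a).
Proof. by have := acomp_linear_r c k a 0; rewrite !addr0 acomp0r addr0. Qed.

Lemma astarD r s (a b : arrow r s) : (a + b)^# = a^# + b^#.
Proof. by have := astar_antilinear 1 a b; rewrite rmorph1 !scale1r. Qed.

Lemma astar0 r s : (0 : arrow r s)^# = 0.
Proof. by apply: (@addrI _ (0^#)); rewrite -astarD !addr0. Qed.

Lemma astarZ r s k (a : arrow r s) : (k *: a)^# = conjc k *: a^#.
Proof. by have := astar_antilinear k a 0; rewrite !addr0 astar0 addr0. Qed.

Lemma astarB r s (a b : arrow r s) : (a - b)^# = a^# - b^#.
Proof. by rewrite -scaleN1r astarD astarZ rmorphN1 scaleN1r. Qed.

Lemma astar_continuous r s : continuous (@astar _ C r s).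
Proof.
move=> a; apply/cvgrPdist_lt => e e0.
have /cvgrPdist_lt/(_ _ e0) := @cvg_id _ (nbhs a).
by apply: filterS => b; rewrite -astarB astar_norm.
Qed.

End CstarTheory.

(** The multiplier algebra M(r, r) of arrow r r: double centralizers (L, R),
    where L a stands for m a and R a for a m. *)

Section Multiplier.
Variables (R : realType) (C : CstarCategory R) (r : C).
Local Notation A := (arrow r r).

Definition multiplier_pred : {pred (A -> A) * (A -> A)} := fun m => `[<
  [/\ linear m.1 /\ continuous m.1, linear m.2 /\ continuous m.2,
      forall a b, m.1 (a \oc b) = m.1 a \oc b,
      forall a b, m.2 (a \oc b) = a \oc m.2 b &
      forall a b, m.2 a \oc b = a \oc m.1 b] >].

Lemma multiplier_submod_closed : submod_closed multiplier_pred.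
Proof.
split=> [|k [L1 R1] [L2 R2] /asboolP/=
    [[lL1 cL1] [lR1 cR1] L1M R1M LR1] /asboolP/= [[lL2 cL2] [lR2 cR2] L2M R2M LR2]];
  apply/asboolP; split=> /=.
- by split=> [k a b|x]; [rewrite /= scaler0 addr0|exact: cvg_cst].
- by split=> [k a b|x]; [rewrite /= scaler0 addr0|exact: cvg_cst].
- by move=> a b /=; rewrite acomp0l.
- by move=> a b /=; rewrite acomp0r.
- by move=> a b /=; rewrite acomp0l acomp0r.
- split=> [l a b|x].
    rewrite /= !fctE lL1 lL2 !scalerDr !scalerA mulrC addrACA.
    by rewrite -!scalerA.
  by apply: cvgD; [apply: cvgZr; exact: cL1|exact: cL2].
- split=> [l a b|x].
    rewrite /= !fctE lR1 lR2 !scalerDr !scalerA mulrC addrACA.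
    by rewrite -!scalerA.
  by apply: cvgD; [apply: cvgZr; exact: cR1|exact: cR2].
- by move=> a b; rewrite /= !fctE L1M L2M acompDl acompZl.
- by move=> a b; rewrite /= !fctE R1M R2M acompDr acompZr.
- by move=> a b; rewrite /= !fctE acompDl acompDr acompZl acompZr LR1 LR2.
Qed.
HB.instance Definition _ := GRing.isSubmodClosed.Build _ _ multiplier_pred
  multiplier_submod_closed.

Record multiplier := MkMultiplier {
  mult_pair : (A -> A) * (A -> A);
  mult_pairP : mult_pair \in multiplier_pred }.
HB.instance Definition _ := [isSub for mult_pair].
HB.instance Definition _ := [Choice of multiplier by <:].
HB.instance Definition _ := [SubChoice_isSubLmodule of multiplier by <:].

Definition multL (m : multiplier) : A -> A := (mult_pair m).1.
Definition multR (m : multiplier) : A -> A := (mult_pair m).2.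

Lemma mult_mul_subproof (m n : multiplier) :
  (multL m \o multL n, multR n \o multR m) \in multiplier_pred.
Proof.
have /asboolP[[lL1 cL1] [lR1 cR1] L1M R1M LR1] := mult_pairP m.
have /asboolP[[lL2 cL2] [lR2 cR2] L2M R2M LR2] := mult_pairP n.
apply/asboolP; split=> /=; rewrite /multL /multR.
- split=> [k a b|x]; first by rewrite /= lL2 lL1.
  by apply: continuous_comp; [exact: cL2|exact: cL1].
- split=> [k a b|x]; first by rewrite /= lR1 lR2.
  by apply: continuous_comp; [exact: cR1|exact: cR2].
- by move=> a b /=; rewrite L2M L1M.
- by move=> a b /=; rewrite R1M R2M.
- by move=> a b /=; rewrite LR2 LR1.
Qed.
Definition mult_mul (m n : multiplier) : multiplier :=
  MkMultiplier (mult_mul_subproof m n).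

Lemma mult_star_subproof (m : multiplier) :
  (fun a => (multR m a^#)^#, fun a => (multL m a^#)^#) \in multiplier_pred.
Proof.
have /asboolP[[lL cL] [lR cR] LM RM LR] := mult_pairP m.
have astarc : continuous (@astar _ C r r) by exact: astar_continuous.
apply/asboolP; split=> /=; rewrite /multL /multR.
- split=> [k a b|x].
    by rewrite /= astarD astarZ lR astarD astarZ conjcK.
  apply: (@continuous_comp _ _ _ (fun a => (mult_pair m).2 a^#) (@astar _ C r r)).
    by apply: continuous_comp; [exact: astarc|exact: cR].
  exact: astarc.
- split=> [k a b|x].
    by rewrite /= astarD astarZ lL astarD astarZ conjcK.
  apply: (@continuous_comp _ _ _ (fun a => (mult_pair m).1 a^#) (@astar _ C r r)).
    by apply: continuous_comp; [exact: astarc|exact: cL].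
  exact: astarc.
- by move=> a b /=; rewrite astar_comp RM astar_comp astarK.
- by move=> a b /=; rewrite astar_comp LM astar_comp astarK.
- move=> a b; rewrite -[LHS]astarK astar_comp astarK -LR.
  by rewrite -[RHS]astarK [in RHS]astar_comp astarK.
Qed.
Definition mult_star (m : multiplier) : multiplier :=
  MkMultiplier (mult_star_subproof m).

End Multiplier.

Section Action.
Variables (R : realType) (C : CstarCategory R).

(* A net is encoded by the filter generated by its tails. *)
Definition is_approximate_unit (r : C) (E : set_system (arrow r r)) : Prop :=
  [/\ ProperFilter E,
      \forall e \near E, (exists a : arrow r r, e = a^# \oc a) /\ `|e| <= 1,
      forall a : arrow r r, e \oc a @[e --> E] --> a &
      forall a : arrow r r, a \oc e @[e --> E] --> a].

(* Some approximate unit of arrow r r; the limits below do not depend on it. *)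
Definition approximate_unit (r : C) : set_system (arrow r r) :=
  get (@is_approximate_unit r).
Arguments approximate_unit : clear implicits.

(* t m is the limit of t (e m), and m t that of (m e) t, for e running through
   the approximate unit. *)
Definition rmult (r s : C) (t : arrow r s) (m : multiplier r) : arrow r s :=
  lim (t \oc multR m e @[e --> approximate_unit r]).

Definition lmult (r s : C) (m : multiplier s) (t : arrow r s) : arrow r s :=
  lim (multL m e \oc t @[e --> approximate_unit s]).

Definition is_Cstar_morphism (X : topologicalType) (r : C)
    (i : C0 R X -> multiplier r) : Prop :=
  [/\ linear i,
      forall f g, i (C0_mul f g) = mult_mul (i f) (i g) &
      forall f, i (C0_conj f) = mult_star (i f)].

Definition nondegenerate (X : topologicalType) (r : C)
    (i : C0 R X -> multiplier r) : Prop :=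
  closure (linear_span [set multL (i f) a | f in setT & a in setT]) = setT.

End Action.
Arguments approximate_unit {R C} r.

Record C0Category (R : realType) (X : topologicalType) := MkC0Category {
  C0cat :> CstarCategory R;
  C0map : forall r : C0cat, C0 R X -> multiplier r;
  C0map_morphism : forall r : C0cat, is_Cstar_morphism (@C0map r);
  C0map_nondegenerate : forall r : C0cat, nondegenerate (@C0map r);
  C0map_central : forall (r s : C0cat) (t : arrow r s) (f : C0 R X),
    rmult t (@C0map r f) = lmult (@C0map s f) t
}.
Arguments C0map {R X} c r f.

Section Fibre.
Variables (R : realType) (X : topologicalType) (C : C0Category R X).

(* f t = t f; by C0map_central the left action gives the same arrow. *)
Definition C0_act (r s : C) (f : C0 R X) (t : arrow r s) : arrow r s :=
  rmult t (C0map C r f).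

Variables (x : X) (r s : C).

Definition fibre_kernel : closedSubspace (arrow r s) :=
  closed_span [set C0_act f t | f in @C0_vanishing_at R X x & t in [set: arrow r s]].

Definition fibre : normedModType R[i] := quotient_space fibre_kernel.

(* The fibre functor is the identity on objects. *)
Definition fibre_map : arrow r s -> fibre := @quotient_map _ _ fibre_kernel.

End Fibre.

(* Main.v *)
Require Import Defs.
From HB Require Import structures.
From mathcomp Require Import all_boot all_order all_algebra.
From mathcomp Require Import complex ring lra.
From mathcomp Require Import all_classical all_reals all_analysis.

(** The space of arrows [arrow r s] is a Banach module over [C_0(X)], and the
   fibre norm at [x] is the infimum of the [|h t|] over the real functions [h]
   in [C_0(X)] with [0 <= h <= 1] and [h = 1] near [x].  Upper semicontinuity is
   immediate from this, and vanishing at infinity follows from the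
   nondegeneracy of the action, since [pi_x (f t) = f(x) pi_x(t)].  For the
   supremum, let [c > |pi_x(t)|] for all [x], and let [f >= 0] have compact
   support with [f t] close to [t].  Compactness gives finitely many [h_j] with
   [|h_j t| <= c] and [f^n <= sum_j h_j^n], so with [b = t^* t] the C*-identity
   yields, for [n = 2^k] and [N] the number of the [h_j],
   [|f t|^(2n) = |f^(2n) b^n| <= sum_j |h_j^(2n) b^n| = sum_j |h_j t|^(2n)
   <= N c^(2n)], and the [2n]-th root of [N] tends to 1.

   The action is defined by limits along an approximate unit of [arrow r r],
   whose existence needs no spectral theory: it is built from polynomials in
   selfadjoint elements that are contractive because they are means of powers
   of unitaries. *)

Set Implicit Arguments.
Unset Strict Implicit.
Unset Printing Implicit Defensive.

Import Order.TTheory GRing.Theory Num.Theory.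
Import numFieldNormedType.Exports.
Local Open Scope classical_set_scope.
Local Open Scope ring_scope.
Local Open Scope complex_scope.
Local Open Scope cstar_scope.

(** * Real-valued norms, limits and closures in complex normed spaces *)

Section RealNorm.
Context {R : realType} {V : normedModType R[i]}.
Implicit Types (u v : V) (a e : R).

Lemma gt0_realE (z : R[i]) : 0 < z -> z = (complex.Re z)%:C /\ 0 < complex.Re z.
Proof.
move=> z0; rewrite RRe_real ?gtr0_real//; split=> //.
by move: z0; rewrite ltcE => /andP[].
Qed.

Lemma rnorm0 : rnorm (0 : V) = 0.
Proof. by rewrite /rnorm normr0. Qed.

Lemma rnormN v : rnorm (- v) = rnorm v.
Proof. by rewrite /rnorm normrN. Qed.

Lemma rnormB u v : rnorm (u - v) = rnorm (v - u).
Proof. by rewrite /rnorm distrC. Qed.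

Lemma rnormZ (k : R[i]) v : rnorm (k *: v) = rnorm k * rnorm v.
Proof. by apply: complexI; rewrite rmorphM/= -!rnormE normrZ. Qed.

Lemma rnormC a : rnorm (a%:C : R[i]) = `|a|.
Proof. by apply: complexI; rewrite -rnormE normc_def/= expr0n addr0 sqrtr_sqr. Qed.

Lemma rnormZr a v : rnorm (a%:C *: v) = `|a| * rnorm v.
Proof. by rewrite rnormZ rnormC. Qed.

Lemma rnorm_eq0 v : rnorm v <= 0 -> v = 0.
Proof.
move=> v0; apply/normr0_eq0; rewrite rnormE; congr (_%:C); apply: le_anti.
by rewrite v0 rnorm_ge0.
Qed.

Lemma ler_rnormB u v : rnorm (u - v) <= rnorm u + rnorm v.
Proof. by rewrite -(rnormN v); exact: ler_rnormD. Qed.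

Lemma ler_rnorm_dist w u v : rnorm (u - v) <= rnorm (u - w) + rnorm (w - v).
Proof. by rewrite (le_trans _ (ler_rnormD _ _))// addrA subrK. Qed.

Lemma ler_rnorm_sub u v : rnorm u <= rnorm v + rnorm (u - v).
Proof. by rewrite (le_trans _ (ler_rnormD _ _))// addrC subrK. Qed.

Lemma ler_rnorm_sum (I : Type) (s : seq I) (P : pred I) (F : I -> V) :
  rnorm (\sum_(i <- s | P i) F i) <= \sum_(i <- s | P i) rnorm (F i).
Proof.
elim/big_rec2: _ => [|i x y _ xy]; first by rewrite rnorm0.
by rewrite (le_trans (ler_rnormD _ _))// lerD2l.
Qed.

Lemma rcvgP {T : Type} (F : set_system T) {FF : Filter F} (f : T -> V) (l : V) :
  f x @[x --> F] --> l <-> (forall e, 0 < e -> \forall x \near F, rnorm (l - f x) < e).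
Proof.
split=> [/cvgrPdist_lt fl e e0|fl].
  have e0' : 0 < e%:C :> R[i] by rewrite ltcR.
  by apply: filterS (fl _ e0') => x; rewrite rnormE ltcR.
apply/cvgrPdist_lt => e /gt0_realE[-> e0].
by apply: filterS (fl _ e0) => x; rewrite rnormE ltcR.
Qed.

Lemma rclosureP (A : set V) v :
  closure A v <-> (forall e, 0 < e -> exists2 u, A u & rnorm (v - u) < e).
Proof.
split=> [Av e e0|Av B /nbhs_ballP[e/= /gt0_realE[-> e0] eB]].
  have e0' : 0 < e%:C :> R[i] by rewrite ltcR.
  have [u [Au vu]] := Av _ (nbhsx_ballx v _ e0'); exists u => //.
  by move: vu; rewrite -ball_normE/= rnormE ltcR.
have [u Au vu] := Av _ e0; exists u; split=> //; apply: eB.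
by rewrite -ball_normE/= rnormE ltcR.
Qed.

Lemma cvg_rnorm_le {T : Type} (F : set_system T) {FF : ProperFilter F}
    (f : T -> V) (l : V) a :
  f x @[x --> F] --> l -> (forall x, rnorm (f x) <= a) -> rnorm l <= a.
Proof.
move=> /rcvgP fl fa; apply/ler_addgt0Pr => e e0.
have [x xe] := filter_ex (fl _ e0).
by rewrite (le_trans (ler_rnorm_sub _ (f x)))// lerD// ltW.
Qed.

End RealNorm.

Lemma rcauchy_cvg (R : realType) (V : completeNormedModType R[i])
    (F : set_system V) {FF : ProperFilter F} :
  (forall e : R, 0 < e -> exists v, \forall u \near F, rnorm (v - u) < e) -> cvg F.
Proof.
move=> cF; apply/cauchy_cvgP/cauchy_exP => e /gt0_realE[-> e0].
have [v ve] := cF _ e0; exists v.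
by apply: filterS ve => u; rewrite -ball_normE/= rnormE ltcR.
Qed.

(** * Norm estimates and continuity of composition *)

Section CstarNorm.
Context {R : realType} {C : CstarCategory R}.
Implicit Types r s u : C.

Lemma acompNl r s u (a : arrow s u) (b : arrow r s) : (- a) \oc b = - (a \oc b).
Proof. by rewrite -scaleN1r acompZl scaleN1r. Qed.

Lemma acompNr r s u (a : arrow s u) (b : arrow r s) : a \oc (- b) = - (a \oc b).
Proof. by rewrite -scaleN1r acompZr scaleN1r. Qed.

Lemma acompBl r s u (a b : arrow s u) (c : arrow r s) :
  (a - b) \oc c = a \oc c - b \oc c.
Proof. by rewrite acompDl acompNl. Qed.

Lemma acompBr r s u (c : arrow s u) (a b : arrow r s) :
  c \oc (a - b) = c \oc a - c \oc b.
Proof. by rewrite acompDr acompNr. Qed.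

Lemma rnorm_acomp r s u (a : arrow s u) (b : arrow r s) :
  rnorm (a \oc b) <= rnorm a * rnorm b.
Proof. by rewrite -lecR rmorphM/= -!rnormE acomp_norm. Qed.

Lemma rnorm_astar r s (a : arrow r s) : rnorm a^# = rnorm a.
Proof. by rewrite /rnorm astar_norm. Qed.

Lemma rnorm_cstar r s (a : arrow r s) : rnorm (a^# \oc a) = rnorm a ^+ 2.
Proof. by apply: complexI; rewrite rmorphXn/= -!rnormE cstar_norm. Qed.

Lemma rnorm_cstarV r s (a : arrow r s) : rnorm (a \oc a^#) = rnorm a ^+ 2.
Proof. by rewrite -{1}[a]astarK rnorm_cstar rnorm_astar. Qed.

Lemma acomp_cvgl (T : Type) (F : set_system T) {FF : Filter F} r s u
    (f : T -> arrow s u) (a : arrow s u) (b : arrow r s) :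
  f x @[x --> F] --> a -> f x \oc b @[x --> F] --> a \oc b.
Proof.
move=> /rcvgP fa; apply/rcvgP => e e0.
have b0 : 0 < rnorm b + 1 by rewrite ltr_wpDl// rnorm_ge0.
apply: filterS (fa _ (divr_gt0 e0 b0)) => x; rewrite -acompBl ltr_pdivlMr//.
apply: le_lt_trans; rewrite (le_trans (rnorm_acomp _ _))// ler_wpM2l ?rnorm_ge0//.
by rewrite lerDl.
Qed.

Lemma acomp_cvgr (T : Type) (F : set_system T) {FF : Filter F} r s u
    (f : T -> arrow r s) (a : arrow r s) (b : arrow s u) :
  f x @[x --> F] --> a -> b \oc f x @[x --> F] --> b \oc a.
Proof.
move=> /rcvgP fa; apply/rcvgP => e e0.
have b0 : 0 < rnorm b + 1 by rewrite ltr_wpDl// rnorm_ge0.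
apply: filterS (fa _ (divr_gt0 e0 b0)) => x; rewrite -acompBr ltr_pdivlMr//.
apply: le_lt_trans; rewrite (le_trans (rnorm_acomp _ _))// mulrC.
by rewrite ler_wpM2l ?rnorm_ge0// lerDl.
Qed.

End CstarNorm.

(* Embedding a module [V] over [K] in the commutative ring [K + V], where
   [V^2 = 0], makes identities between vectors accessible to [ring]. *)
Section TrivialExtension.
Variables (K : comNzRingType) (V : lmodType K).

Definition triv_ext : Type := (K * V)%type.
HB.instance Definition _ := GRing.Zmodule.on triv_ext.
Local Notation E := triv_ext.

Definition triv_ext_one : E := (1, 0).
Definition triv_ext_mul (x y : E) : E := (x.1 * y.1, x.1 *: y.2 + y.1 *: x.2).

Lemma triv_ext_mulA : associative triv_ext_mul.
Proof.
move=> [a u] [b v] [c w]; rewrite /triv_ext_mul/= !scalerDr !scalerA mulrA addrA.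
by congr pair; rewrite [c * a]mulrC [c * b]mulrC.
Qed.

Lemma triv_ext_mulC : commutative triv_ext_mul.
Proof. by move=> x y; rewrite /triv_ext_mul mulrC addrC. Qed.

Lemma triv_ext_mul1 : left_id triv_ext_one triv_ext_mul.
Proof. by move=> [a u]; rewrite /triv_ext_mul/= mul1r scale1r scaler0 addr0. Qed.

Lemma triv_ext_mulDl : left_distributive triv_ext_mul +%R.
Proof.
move=> [a u] [b v] [c w]; rewrite /triv_ext_mul/=.
by congr pair; rewrite ?mulrDl// scalerDl scalerDr addrACA.
Qed.

Lemma triv_ext_one_neq0 : triv_ext_one != 0 :> E.
Proof. by apply/eqP => -[/eqP]; rewrite oner_eq0. Qed.

HB.instance Definition _ := GRing.Zmodule_isComNzRing.Build E
  triv_ext_mulA triv_ext_mulC triv_ext_mul1 triv_ext_mulDl triv_ext_one_neq0.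

Definition ext_scalar (k : K) : E := (k, 0).
Definition ext_vector (v : V) : E := (0, v).

Lemma ext_scalar_zmod : zmod_morphism ext_scalar.
Proof. by move=> a b; congr pair; rewrite /= subr0. Qed.
HB.instance Definition _ :=
  GRing.isZmodMorphism.Build K E ext_scalar ext_scalar_zmod.
Lemma ext_scalar_monoid : monoid_morphism ext_scalar.
Proof. by split=> // a b; congr pair; rewrite /= !scaler0 addr0. Qed.
HB.instance Definition _ :=
  GRing.isMonoidMorphism.Build K E ext_scalar ext_scalar_monoid.

Lemma ext_vectorD u v : ext_vector (u + v) = ext_vector u + ext_vector v.
Proof. by congr pair; rewrite /= addr0. Qed.

Lemma ext_vector0 : ext_vector 0 = 0.
Proof. by []. Qed.

Lemma ext_vectorN v : ext_vector (- v) = - ext_vector v.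
Proof. by congr pair; rewrite /= oppr0. Qed.

Lemma ext_vectorZ k v : ext_vector (k *: v) = ext_scalar k * ext_vector v.
Proof. by congr pair; rewrite /= ?mulr0// scale0r addr0. Qed.

Lemma ext_vector_inj : injective ext_vector.
Proof. by move=> u v []. Qed.

End TrivialExtension.

Ltac lmodule_embed := apply: ext_vector_inj;
  repeat (rewrite ext_vectorZ || rewrite ext_vectorD || rewrite ext_vectorN
    || rewrite ext_vector0).
Ltac lmodule := lmodule_embed; ring.

Ltac acomp_expand :=
  repeat progress
    rewrite ?(acompDl, acompDr, acompNl, acompNr, acompZl, acompZr, acompA).

(** * Square roots and Chebyshev polynomials of selfadjoint elements *)

Section Sqrt.
Context {R : realType} {C : CstarCategory R} {r : C}.
Local Notation A := (arrow r r).
Implicit Types (a b q v w : A).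

(** After adjoining a unit, [w] is [1 - sqrt (1 - q^2)]: the last equation reads
    [(1 - w)^2 = 1 - q^2]. It is the fixed point of [w |-> (q^2 + w^2) / 2], which maps the ball of
    radius [rnorm q] into itself and is Lipschitz there with constant [rnorm q < 1]. *)
Lemma unit_sqrt q : q^# = q -> rnorm q < 1 ->
  exists w, [/\ w^# = w, w \oc q = q \oc w & q \oc q + w \oc w = w + w].
Proof.
move=> sq q1; set p := rnorm q in q1.
have p0 : 0 <= p by exact: rnorm_ge0.
pose F w := (2^-1)%:C *: (q \oc q + w \oc w).
pose I w := [/\ w^# = w, w \oc q = q \oc w & rnorm w <= p].
have half : `|2^-1 : R| = 2^-1 by rewrite ger0_norm.
have IF w : I w -> I (F w).
  move=> [sw cw wp]; split.
  - by rewrite astarZ astarD !astar_comp sq sw conjc_real.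
  - by rewrite /F acompZl acompZr acompDl acompDr !acompA -cw -!acompA -cw.
  - rewrite rnormZr half ler_pdivrMl//.
    rewrite (le_trans (ler_rnormD _ _))//.
    have := rnorm_acomp q q; have := rnorm_acomp w w; rewrite -/p.
    have := rnorm_ge0 w; nra.
have Flip v w : I v -> I w -> rnorm (F v - F w) <= p * rnorm (v - w).
  move=> [_ _ vp] [_ _ wp]; rewrite -scalerBr rnormZr half ler_pdivrMl//.
  have -> : q \oc q + v \oc v - (q \oc q + w \oc w) =
      v \oc (v - w) + (v - w) \oc w.
    by rewrite opprD addrACA subrr add0r acompBr acompBl addrA subrK.
  rewrite (le_trans (ler_rnormD _ _))//.
  have := rnorm_acomp v (v - w); have := rnorm_acomp (v - w) w.
  have := rnorm_ge0 (v - w); nra.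
have I0 : I 0 by split; rewrite ?astar0 ?acomp0l ?acomp0r ?rnorm0.
pose u n := iter n F 0.
have Iu n : I (u n) by elim: n => //= n; exact: IF.
have ulip n (v w : A) : I v -> I w ->
    rnorm (iter n F v - iter n F w) <= p ^+ n * rnorm (v - w).
  have Ii x k : I x -> I (iter k F x) by move=> Ix; elim: k => //= k; exact: IF.
  move=> Iv Iw; elim: n => [|n IH]; first by rewrite expr0 mul1r.
  rewrite /= (le_trans (Flip _ _ (Ii _ _ Iv) (Ii _ _ Iw)))// exprS -mulrA.
  by rewrite ler_wpM2l.
have cu : cvg (u n @[n --> \oo]).
  apply: rcauchy_cvg => e e0.
  have pn0 : (p ^+ n) @[n --> \oo] --> (0 : R).
    by apply: cvg_expr; rewrite ger0_norm.
  have /cvgrPdist_lt/(_ e e0)[N _ /(_ N (leqnn N))] := pn0.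
  rewrite sub0r normrN ger0_norm ?exprn_ge0// => pN.
  exists (u N); exists N => // n /= Nn.
  (* [u n] and [u N] are the images under the [N]-th iterate of [F] of [u (n - N)] and [0]. *)
  rewrite -(subnKC Nn) /u iterD (le_lt_trans (ulip _ _ _ I0 (Iu _)))//.
  apply: le_lt_trans pN; rewrite ler_piMr ?exprn_ge0//.
  by rewrite sub0r rnormN; case: (Iu (n - N)%N) => _ _ /le_trans; apply; exact: ltW.
set w := lim (u n @[n --> \oo]) in cu.
have wp : rnorm w <= p by apply: (cvg_rnorm_le cu) => n; case: (Iu n).
have uw e : 0 < e -> exists n, rnorm (w - u n) < e /\ rnorm (w - u n.+1) < e.
  move=> e0; have /rcvgP/(_ e e0)[N _ uN] := cu.
  by exists N; split; apply: uN => /=.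
(* Identities for [w] are inherited from the iterates: the defect is bounded by the errors of two
   consecutive iterates, which can be made arbitrarily small. *)
have eq_lim (x y : A) (K : R) : 0 <= K ->
    (forall n, rnorm (x - y) <= K * rnorm (w - u n) + K * rnorm (w - u n.+1)) -> x = y.
  move=> K0 xy; apply: subr0_eq; apply: rnorm_eq0; apply/ler_addgt0Pr => e e0.
  rewrite add0r; have K1 : 0 < 2 * K + 1 by lra.
  have [n [n1 n2]] := uw _ (divr_gt0 e0 K1); rewrite (le_trans (xy n))//.
  move: n1 n2; rewrite !ltr_pdivlMr//; have := rnorm_ge0 (w - u n).
  have := rnorm_ge0 (w - u n.+1); nra.
exists w; split.
- apply: (eq_lim _ _ 2) => // n; have [su _ _] := Iu n.
  rewrite (le_trans (ler_rnorm_dist (u n) _ _))// -{1}su -astarB rnorm_astar.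
  rewrite [rnorm (u n - w)]rnormB; have := rnorm_ge0 (w - u n.+1); lra.
- apply: (eq_lim _ _ 2) => // n; have [_ cu' _] := Iu n.
  rewrite (le_trans (ler_rnorm_dist (u n \oc q) _ _))// {2}cu' -acompBl -acompBr.
  have := rnorm_acomp (w - u n) q; have := rnorm_acomp q (u n - w).
  rewrite [rnorm (u n - w)]rnormB -/p.
  have := rnorm_ge0 (w - u n.+1); have := rnorm_ge0 (w - u n); nra.
- have Fw : F w = w.
    apply: (eq_lim _ _ 1) => // n; rewrite !mul1r.
    rewrite (le_trans (ler_rnorm_dist (u n.+1) _ _))//.
    rewrite [rnorm (u n.+1 - w)]rnormB lerD2r /= -scalerBr rnormZr half ler_pdivrMl//.
    have -> : q \oc q + w \oc w - (q \oc q + u n \oc u n) =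
        w \oc (w - u n) + (w - u n) \oc u n.
      by rewrite opprD addrACA subrr add0r acompBr acompBl addrA subrK.
    rewrite (le_trans (ler_rnormD _ _))//; have [_ _ up] := Iu n.
    have := rnorm_acomp w (w - u n); have := rnorm_acomp (w - u n) (u n).
    have := rnorm_ge0 (w - u n); nra.
  have -> : w + w = F w + F w by rewrite Fw.
  by rewrite /F -scalerDl -rmorphD/= -div1r -splitr scale1r.
Qed.

End Sqrt.

Section Chebyshev.
Context {R : realType} {C : CstarCategory R} {r : C}.
Local Notation A := (arrow r r).
Implicit Types (a b q v w : A).

(* With [s^2 = 1 - q^2] the operator [U = q + i s] is unitary and
   [U + U^* = 2 q], so the Chebyshev polynomials [T_2] and [T_3] of [q] are the
   contractions [(U^n + U^*^n) / 2]. *)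
Lemma chebyshev_contraction q b : q^# = q -> rnorm q < 1 ->
  rnorm (2 *: (q \oc (q \oc b)) - b) <= rnorm b /\
  rnorm (4 *: (q \oc (q \oc (q \oc b))) - 3 *: (q \oc b)) <= rnorm b.
Proof.
move=> sq q1; have [w [sw wq qw]] := unit_sqrt sq q1.
(* With [s = 1 - w] this is the operator [q + k s]; it is used for [k = 'i] and [k = - 'i]. *)
pose U (k : R[i]) (b : A) := q \oc b + k *: (b - w \oc b).
have UZ k j c : U k (j *: c) = j *: U k c.
  by rewrite /U; acomp_expand; lmodule.
have UD k c d : U k (c + d) = U k c + U k d.
  by rewrite /U; acomp_expand; lmodule.
have UB k c d : U k (c - d) = U k c - U k d by rewrite -scaleN1r UD UZ scaleN1r.
(* [(q - k s) (q + k s) = q^2 + s^2 = 1], as [q] and [s] commute and [k^2 = -1]. *)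
have UV (k : R[i]) (c : A) : k ^+ 2 = -1 -> U (- k) (U k c) = c.
  move=> k2; have wwc : w \oc w \oc c = w \oc c + w \oc c - q \oc q \oc c.
    by rewrite -acompDl -qw acompDl addrAC subrr add0r.
  have kE := congr1 (@ext_scalar _ A) k2.
  by rewrite /U; acomp_expand; rewrite wq wwc; lmodule_embed; ring: kE.
have UN k c : U k c + U (- k) c = 2 *: (q \oc c) by rewrite /U; lmodule.
have i2 : 'i ^+ 2 = -1 :> R[i] by rewrite sqr_i.
have iN2 : (- 'i) ^+ 2 = -1 :> R[i] by rewrite sqrrN sqr_i.
have Uadj (k : R[i]) (c d : A) : conjc k = - k ->
    (U k c)^# \oc d = c^# \oc U (- k) d.
  move=> kN; rewrite /U astarD astarZ astarB !astar_comp sq sw kN.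
  by acomp_expand; lmodule.
have isoU (k : R[i]) (c : A) : k ^+ 2 = -1 -> conjc k = - k -> rnorm (U k c) = rnorm c.
  move=> k2 kN; apply/eqP; rewrite -(@eqrXn2 _ 2)// ?rnorm_ge0//.
  rewrite -!rnorm_cstar; apply/eqP; congr rnorm.
  by rewrite Uadj// UV.
have ci : conjc 'i = - 'i :> R[i] by apply/eqP; rewrite eq_complex/= oppr0 !eqxx.
have cNi : conjc (- 'i) = - - 'i :> R[i] by apply/eqP; rewrite eq_complex/= ?oppr0 ?opprK !eqxx.
have rU := isoU _ _ i2 ci; have rV := isoU _ _ iN2 cNi.
have UVi (c : A) : U 'i (U (- 'i) c) = c by rewrite -[X in U X]opprK UV.
have VUi (c : A) : U (- 'i) (U 'i c) = c by exact: UV.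
have two (x y z : A) : 2 *: x = y + z -> rnorm y = rnorm b -> rnorm z = rnorm b ->
    rnorm x <= rnorm b.
  move=> xyz yb zb; have := ler_rnormD y z; rewrite -xyz yb zb.
  rewrite -[2](rmorph_nat (real_complex R)) rnormZr ger0_norm//; lra.
(* Multiplying [U + U^-1 = 2 q] by [U] gives [U^2 = 2 U q - 1]. *)
have UU (c : A) : U 'i (U 'i c) = 2 *: U 'i (q \oc c) - c.
  by rewrite -{3}(UVi c) -UZ -UB -(UN 'i) addrK.
have VV (c : A) : U (- 'i) (U (- 'i) c) = 2 *: U (- 'i) (q \oc c) - c.
  by rewrite -{3}(VUi c) -UZ -UB -(UN 'i) [X in U _ (X - _)]addrC addrK.
split.
  apply: (two _ (U 'i (U 'i b)) (U (- 'i) (U (- 'i) b))); rewrite ?rU ?rV//.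
  by rewrite UU VV /U; lmodule.
apply: (two _ (U 'i (U 'i (U 'i b))) (U (- 'i) (U (- 'i) (U (- 'i) b))));
  rewrite ?rU ?rV//.
by rewrite (UU b) (VV b) !(UB, UZ) UU VV /U; acomp_expand; lmodule.
Qed.

End Chebyshev.

Lemma scale_half (R : realType) (V : normedModType R[i]) (v : V) :
  (2^-1 : R)%:C *: (2 *: v) = v.
Proof. by rewrite scalerA fmorphV rmorph_nat mulVf ?pnatr_eq0// scale1r. Qed.

(** * Existence of an approximate unit *)

Section ApproximateUnit.
Context {R : realType} {C : CstarCategory R} {r : C}.
Local Notation A := (arrow r r).
Implicit Types (a b c k l q : A) (e : R).

(* [1 - k] is a contraction; [1] need not exist. *)
Definition cocontraction k := forall b, rnorm (b - k \oc b) <= rnorm b.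

Lemma cocontraction0 : cocontraction 0.
Proof. by move=> b; rewrite acomp0l subr0. Qed.

(** [1 - (k + l - k l) = (1 - k) (1 - l)] is a product of contractions. *)
Lemma cocontraction_circ k l :
  cocontraction k -> cocontraction l -> cocontraction (k + l - k \oc l).
Proof.
move=> hk hl b; apply: le_trans (hl b); apply: le_trans (hk _).
by rewrite le_eqVlt; apply/orP; left; apply/eqP; congr rnorm; acomp_expand; lmodule.
Qed.

(** For [z = (1 - k^#) b] the C*-identity gives [|z|^2 = |b^# (1 - k) z| <= |b| |z|]. *)
Lemma cocontraction_astar k : cocontraction k -> cocontraction k^#.
Proof.
move=> hk b; set z := b - _; have := rnorm_ge0 z.
rewrite le_eqVlt => /predU1P[<-|z0]; first exact: rnorm_ge0.
rewrite -(ler_pM2r z0) -expr2 -rnorm_cstar.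
have -> : z^# \oc z = b^# \oc (z - k \oc z).
  by rewrite {1}/z astarB astar_comp astarK; acomp_expand; lmodule.
rewrite (le_trans (rnorm_acomp _ _))// rnorm_astar ler_wpM2l ?rnorm_ge0//.
Qed.

Lemma cocontraction_right k b : cocontraction k -> rnorm (b - b \oc k) <= rnorm b.
Proof.
move=> /cocontraction_astar hk; rewrite -rnorm_astar astarB astar_comp.
by rewrite -[leRHS]rnorm_astar.
Qed.

(** Contractivity at [k^#] gives [|k|^2 = |k k^#| <= 2 |k|]. *)
Lemma cocontraction_norm k : cocontraction k -> rnorm k <= 2.
Proof.
move=> hk; have := ler_rnorm_sub (k \oc k^#) k^#.
have := hk k^#; rewrite rnormB rnorm_cstarV rnorm_astar.
have := rnorm_ge0 k; nra.
Qed.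

(** The left side is the norm of [(1 - k) a a^# (1 - k^#)], and the right factor is a
    contraction. *)
Lemma cocontraction_cstar k a : cocontraction k ->
  rnorm (a - k \oc a) ^+ 2 <= rnorm (a \oc a^# - k \oc (a \oc a^#)).
Proof.
move=> hk; rewrite -rnorm_cstarV.
have := cocontraction_right (a \oc a^# - k \oc (a \oc a^#)) (cocontraction_astar hk).
apply: le_trans; rewrite le_eqVlt; apply/orP; left; apply/eqP; congr rnorm.
by rewrite astarB astar_comp; acomp_expand; lmodule.
Qed.

(* With [T = 1 - 2 c^2] a contraction, [1 - k] is the Cesaro mean of the [T^j],
   so that [(1 - k) (1 - T) = (1 - T^m) / m]. *)
Lemma cesaro_cocontraction c (m : nat) : c^# = c -> rnorm c < 1 ->
  exists2 k, cocontraction k &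
    rnorm (c \oc c - k \oc (c \oc c)) <= m.+1%:R^-1.
Proof.
move=> sc c1; pose d := 2 *: (c \oc c).
have hd : cocontraction d.
  move=> b; have [+ _] := chebyshev_contraction b sc c1.
  by rewrite rnormB acompZl acompA.
(* [l j] is [1 - T^j], written without the unit. *)
pose l j := iter j (fun l => l + d - l \oc d) 0.
have hl j : cocontraction (l j).
  elim: j => [|j IH]; first exact: cocontraction0.
  exact: cocontraction_circ.
pose k := m.+1%:R^-1 *: \sum_(j < m.+1) l j.
have m0 : 0 < m.+1%:R :> R by [].
have mC : m.+1%:R^-1 = (m.+1%:R^-1 : R)%:C by rewrite fmorphV rmorph_nat.
have meanE b : b - k \oc b = m.+1%:R^-1 *: \sum_(j < m.+1) (b - l j \oc b).
  rewrite sumrB sumr_const card_ord scalerBr -(scaler_nat _ b) scalerA mulVf ?pnatr_eq0//.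
  rewrite scale1r /k acompZl; congr (_ - _ *: _).
  by elim/big_ind2: _ => [|x y z t <- <-|//]; rewrite ?acomp0l ?acompDl.
exists k => [b|].
  rewrite meanE mC rnormZr ger0_norm ?invr_ge0// ler_pdivrMl//.
  rewrite (le_trans (ler_rnorm_sum _ _ _))// mulr_natl -[X in _ *+ X]card_ord.
  by rewrite -sumr_const ler_sum// => j _; exact: hl.
have -> : c \oc c - k \oc (c \oc c) = 2^-1%:C *: (d - k \oc d).
  by rewrite /d acompZr -scalerBr scale_half.
(* [(1 - l j) d = T^j (1 - T)], so the sum telescopes to [l m.+1]. Its norm is at most 2, which the
   factor [2^-1] from [d = 2 c^2] absorbs. *)
have dE j : d - l j \oc d = l j.+1 - l j by rewrite /=; lmodule.
rewrite meanE (eq_bigr _ (fun j _ => dE (val j))).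
rewrite -(big_mkord xpredT (fun j => l j.+1 - l j)) telescope_sumr// subr0.
rewrite mC !rnormZr !ger0_norm ?invr_ge0// mulrCA ler_piMr ?invr_ge0//.
have := cocontraction_norm (hl m.+1); lra.
Qed.

(** Rescale [a] to [x] of norm less than 1 and put [c = x x^#]. Applying [cocontraction_cstar] to
    [x] and then to [c] bounds [|x - k x|^4] by [|c^2 - k c^2|], which the Cesaro mean makes small;
    hence the fourth power of [p * e]. *)
Lemma approximate_unit1 a e : 0 < e ->
  exists2 k, cocontraction k & rnorm (a - k \oc a) < e.
Proof.
move=> e0; have a0 := rnorm_ge0 a; set p := (rnorm a + 1)^-1.
have p0 : 0 < p by rewrite invr_gt0; lra.
pose x := p%:C *: a.
have xp : rnorm x = p * rnorm a by rewrite rnormZr gtr0_norm.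
have x1 : rnorm x < 1 by rewrite xp mulrC ltr_pdivrMr; lra.
have pe0 : 0 < p * e by rewrite mulr_gt0.
have sc : (x \oc x^#)^# = x \oc x^# by rewrite astar_comp astarK.
have c1 : rnorm (x \oc x^#) < 1.
  by rewrite rnorm_cstarV; have := rnorm_ge0 x; nra.
have [m mE] : exists m, m.+1%:R^-1 < (p * e) ^+ 4.
  have := archi_boundP (ltW (exprn_gt0 4 pe0)).
  have e4 : 0 <= ((p * e) ^+ 4)^-1 by rewrite invr_ge0 exprn_ge0// ltW.
  move=> _; exists (Num.bound ((p * e) ^+ 4)^-1).
  rewrite invf_plt ?posrE ?exprn_gt0//.
  by rewrite (lt_le_trans (archi_boundP e4))// ler_nat.
have [k hk kc] := cesaro_cocontraction m sc c1.
exists k => //; rewrite -(ltr_pM2l p0).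
have := cocontraction_cstar x hk.
have := cocontraction_cstar (x \oc x^#) hk; rewrite sc.
have -> : p * rnorm (a - k \oc a) = rnorm (x - k \oc x).
  by rewrite acompZr -scalerBr rnormZr gtr0_norm.
move: (rnorm (x - _)) (rnorm_ge0 (x - k \oc x)) => y y0 h1 h2.
have y4 : y ^+ 4 < (p * e) ^+ 4.
  apply: le_lt_trans mE; apply: le_trans kc; apply: le_trans h1.
  by rewrite (exprM y 2 2) lerXn2r// nnegrE ?exprn_ge0// rnorm_ge0.
by rewrite -(@ltr_pXn2r _ 4)// ?nnegrE// ltW.
Qed.

(** By induction: [k] is chosen for the remainder [(1 - l) a] of the new element, and the factor
    [1 - k] does not increase the earlier remainders [(1 - l) b]. *)
Lemma approximate_unit_seq (s : seq A) e : 0 < e ->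
  exists2 k, cocontraction k & forall a, a \in s -> rnorm (a - k \oc a) < e.
Proof.
move=> e0; elim: s => [|a s [l hl ls]]; first by exists 0 => //; exact: cocontraction0.
have [k hk ka] := approximate_unit1 (a - l \oc a) e0.
have kE b : b - (k + l - k \oc l) \oc b = (b - l \oc b) - k \oc (b - l \oc b).
  by acomp_expand; lmodule.
exists (k + l - k \oc l) => [|b]; first exact: cocontraction_circ.
rewrite inE kE => /predU1P[->//|bs].
by apply: le_lt_trans (ls _ bs); exact: hk.
Qed.

(** For [rnorm q < 1] let [g = - T_3(q)]. Applying the contraction [T_3(q)] to [g] itself gives
    [|g|^2 = |g^# g| <= |g|]. The boundary case is a limit of multiples of [q]. *)
Lemma chebyshev3_norm q : q^# = q -> rnorm q <= 1 ->
  rnorm (3 *: q - 4 *: (q \oc q \oc q)) <= 1.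
Proof.
pose g q := 3 *: q - 4 *: (q \oc q \oc q).
have lt1 p : p^# = p -> rnorm p < 1 -> rnorm (g p) <= 1.
  move=> sp p1; have [_] := chebyshev_contraction (g p) sp p1.
  have gs : (g p)^# = g p.
    by rewrite astarB !astarZ !astar_comp sp acompA !conjc_nat.
  have -> : 4 *: (p \oc (p \oc (p \oc g p))) - 3 *: (p \oc g p) = - ((g p)^# \oc g p).
    by rewrite gs {3}/g; acomp_expand; lmodule.
  rewrite rnormN rnorm_cstar; have := rnorm_ge0 (g p); nra.
move=> sq q1; rewrite -/(g q); apply/ler_addgt0Pr => e e0.
(* Replacing [q] by [(1 - t) q] changes [g q] by at most [3 t + 12 t = 15 t], which is at most [e];
   the summand [e] in the denominator ensures [t < 1]. *)
pose t := e / (15 + e); have te : t * (15 + e) = e by rewrite divfK// gt_eqF//; lra.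
have t0 : 0 < t by rewrite divr_gt0//; lra.
have t1 : t < 1 by rewrite ltr_pdivrMr; lra.
pose p := (1 - t)%:C *: q.
have sp : p^# = p by rewrite astarZ sq conjc_real.
have p1 : rnorm p < 1.
  by rewrite rnormZr ger0_norm; have := rnorm_ge0 q; nra.
rewrite (le_trans (ler_rnorm_sub _ (g p)))// lerD ?lt1//.
have -> : g q - g p = (3 * t)%:C *: q - (4 * (1 - (1 - t) ^+ 3))%:C *: (q \oc q \oc q).
  rewrite /g /p; acomp_expand.
  by rewrite !(rmorphM, rmorphB, rmorphXn, rmorph1, rmorph_nat)/=; lmodule.
rewrite (le_trans (ler_rnormB _ _))// !rnormZr !ger0_norm; [|nra..].
have q3 : rnorm (q \oc q \oc q) <= 1.
  have := rnorm_acomp (q \oc q) q; have := rnorm_acomp q q.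
  have := rnorm_ge0 q; have := rnorm_ge0 (q \oc q); nra.
have : 4 * (1 - (1 - t) ^+ 3) <= 12 * t by nra.
have := rnorm_ge0 (q \oc q \oc q); nra.
Qed.

(** [1 - k = (1 - l^#) (1 - l)] makes [k] selfadjoint, but only of norm at most 2. A contraction is
    recovered by evaluating [3 q - 4 q^3] at [q = k / 2], a polynomial taking the value 1 at
    [q = 1/2]. *)
Lemma selfadjoint_approximate_unit (s : seq A) e : 0 < e ->
  exists u, [/\ u^# = u, rnorm u <= 1 &
    forall a, a \in s -> rnorm (a - u \oc a) < e].
Proof.
move=> e0; have e2 : 0 < e / 2 by rewrite divr_gt0.
have [l hl ls] := approximate_unit_seq s e2.
pose k := l^# + l - l^# \oc l.
have hk : cocontraction k by apply: cocontraction_circ => //; exact: cocontraction_astar.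
have sk : k^# = k by rewrite astarB astarD astar_comp astarK [l + _]addrC.
pose q := (2^-1)%:C *: k.
have sq : q^# = q by rewrite astarZ sk conjc_real.
have q1 : rnorm q <= 1.
  by rewrite rnormZr ger0_norm; have := cocontraction_norm hk; lra.
have kE : k = 2 *: q.
  by rewrite /q scalerA mulrC -scalerA scale_half.
move: q sq q1 kE => q sq q1 kE.
exists (3 *: q - 4 *: (q \oc q \oc q)); split.
- by rewrite astarB !astarZ !astar_comp sq acompA !conjc_nat.
- exact: chebyshev3_norm.
- move=> a /ls al; set b := a - k \oc a; set b' := b - k \oc b.
  (* [1 - 3 q + 4 q^3 = (1 + q) (1 - 2 q)^2] and [1 - 2 q = 1 - k]. *)
  have -> : a - (3 *: q - 4 *: (q \oc q \oc q)) \oc a = b' + q \oc b'.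
    by rewrite /b' /b kE; acomp_expand; lmodule.
  have bl : rnorm b < e / 2.
    apply: le_lt_trans al; apply: le_trans (cocontraction_astar hl _).
    by rewrite le_eqVlt; apply/orP; left; apply/eqP; congr rnorm; rewrite /b /k; acomp_expand; lmodule.
  rewrite (le_lt_trans (ler_rnormD _ _))//.
  have := rnorm_acomp q b'; have := hk b; have := rnorm_ge0 b'; rewrite -/b'; nra.
Qed.

(** The sets [B (s, e)] of positive contractions that are two-sided units on the list [s] up to [e]
    generate the filter. Each is inhabited by the square of a selfadjoint approximate unit. *)
Lemma approximate_unit_exists : exists E, @is_approximate_unit R C r E.
Proof.
pose B (i : seq A * R) := [set u : A | [/\ exists a, u = a^# \oc a, rnorm u <= 1 &
  forall a, a \in i.1 -> rnorm (a - u \oc a) < i.2 /\ rnorm (a - a \oc u) < i.2]].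
pose D := [set i : seq A * R | 0 < i.2].
have BF : Filter (filter_from D B).
  apply: filter_from_filter; first by exists ([::], 1); exact: ltr01.
  move=> [s e] [t d]/= e0 d0; exists (s ++ t, Num.min e d).
    by rewrite /D/= lt_min; apply/andP.
  move=> u [ua u1 ust]; split; split=> // a /= sa.
    by have := ust a; rewrite mem_cat sa => /(_ isT); rewrite !lt_min => -[/andP[-> _] /andP[-> _]].
  by have := ust a; rewrite mem_cat sa orbT => /(_ isT); rewrite !lt_min => -[/andP[_ ->] /andP[_ ->]].
exists (filter_from D B); split.
- apply: filter_from_proper => // -[s e]/= e0; have e2 : 0 < e / 2 by rewrite divr_gt0.
  (* The adjoints are appended because a left estimate on [a^#] is a right estimate on [a]. The
     bound [e / 2] allows for squaring: [a - v v a = (a - v a) + v (a - v a)]. *)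
  have [v [sv v1 vs]] := selfadjoint_approximate_unit (s ++ map (@astar _ _ _ _) s) e2.
  exists (v \oc v); have vv a : rnorm (a - v \oc a) < e / 2 -> rnorm (a - v \oc v \oc a) < e.
    move=> va; rewrite (le_lt_trans (ler_rnorm_dist (v \oc a) _ _))//.
    rewrite -acompA -acompBr; have := rnorm_acomp v (a - v \oc a).
    have := rnorm_ge0 (a - v \oc a); nra.
  split=> [||a /= sa]; first by exists v; rewrite sv.
    have := rnorm_acomp v v; have := rnorm_ge0 v; nra.
  split; first by apply: vv; apply: vs; rewrite mem_cat sa.
  rewrite -rnorm_astar astarB !astar_comp sv; apply: vv; apply: vs.
  by rewrite mem_cat map_f ?orbT.
- exists ([::], 1); first exact: ltr01; move=> u [ua u1 _]; split=> //.
  by rewrite rnormE -[1]/(1%:C) lecR.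
- move=> a; apply/rcvgP => e e0; exists ([:: a], e) => //= u [_ _ /(_ a)].
  by rewrite inE eqxx => /(_ isT)[].
- move=> a; apply/rcvgP => e e0; exists ([:: a], e) => //= u [_ _ /(_ a)].
  by rewrite inE eqxx => /(_ isT)[].
Qed.

Lemma approximate_unitP : is_approximate_unit (approximate_unit r).
Proof. by have [E EP] := approximate_unit_exists; exact: getI EP. Qed.

End ApproximateUnit.

(** * Multipliers and their action on arrows *)

Section Multipliers.
Context {R : realType} {C : CstarCategory R}.
Implicit Types r s u : C.

#[global] Instance approximate_unit_filter r : ProperFilter (approximate_unit r).
Proof. by case: (@approximate_unitP R C r). Qed.

Lemma approximate_unit_le1 r : \forall e \near approximate_unit r, rnorm e <= 1.
Proof.
have [_ h _ _] := @approximate_unitP R C r; apply: filterS h => e [_].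
by rewrite rnormE -[1]/(1%:C) lecR.
Qed.

(** With [b = t^# t], the C*-identity gives [|t - t e|^2 = |(1 - e^#) (b - b e)| <= 2 |b - b e|], a
    quantity in the algebra [arrow r r]. *)
Lemma acomp_approximate_unit r s (t : arrow r s) :
  t \oc e @[e --> approximate_unit r] --> t.
Proof.
apply/rcvgP => d d0; have [_ _ _ /(_ (t^# \oc t))/rcvgP h] := @approximate_unitP R C r.
have d2 : 0 < d ^+ 2 / 2 by rewrite divr_gt0// exprn_gt0.
apply: filterS2 (h _ d2) (approximate_unit_le1 r) => e.
set b := t^# \oc t => be e1.
have : rnorm (t - t \oc e) ^+ 2 <= rnorm (b - b \oc e) + rnorm e * rnorm (b - b \oc e).
  rewrite -rnorm_cstar.
  have -> : (t - t \oc e)^# \oc (t - t \oc e) = (b - b \oc e) - e^# \oc (b - b \oc e).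
    by rewrite astarB astar_comp /b; acomp_expand; lmodule.
  by rewrite (le_trans (ler_rnormB _ _))// lerD2l -(rnorm_astar e) rnorm_acomp.
move: (rnorm_ge0 (b - b \oc e)) (rnorm_ge0 (t - t \oc e)).
by move: (rnorm (t - _)) (rnorm (b - _)) be => x y; nra.
Qed.

Arguments acomp_approximate_unit {r s} t.

Variable (r : C) (m : multiplier r).

Lemma multiplier_props :
  [/\ linear (multL m) /\ continuous (multL m), linear (multR m) /\ continuous (multR m),
      forall a b, multL m (a \oc b) = multL m a \oc b,
      forall a b, multR m (a \oc b) = a \oc multR m b &
      forall a b, multR m a \oc b = a \oc multL m b].
Proof. by have /asboolP := mult_pairP m. Qed.

Lemma multR_bounded : exists2 K : R, 0 < K & forall a, rnorm a <= 1 -> rnorm (multR m a) <= K.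
Proof.
have [_ [lR cR] _ _ _] := multiplier_props.
have R0 : multR m 0 = 0 by have := lR (-1) 0 0; rewrite !scaleN1r !addNr.
have RZ k a : multR m (k *: a) = k *: multR m a.
  by rewrite -[k *: a]addr0 lR R0 addr0.
have /rcvgP/(_ 1 ltr01) := cR 0; rewrite R0 => /nbhs_ballP[z/= z0 dR]; have [zE d0] := gt0_realE z0; rewrite zE in dR.
move: (complex.Re z) d0 dR => d d0 dR; exists (2 / d) => [|a a1]; first by rewrite divr_gt0.
have d2 : 0 < d / 2 by rewrite divr_gt0.
have : rnorm (multR m ((d / 2)%:C *: a)) < 1.
  rewrite -rnormN -sub0r; apply: dR.
  rewrite -ball_normE/= sub0r normrN rnormE ltcR rnormZr gtr0_norm//.
  have := rnorm_ge0 a; nra.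
rewrite RZ rnormZr gtr0_norm// => dRa.
by rewrite ler_pdivlMr//; nra.
Qed.

(** The image filter is Cauchy: if [t u] is close to [t], then [t (e m)] is close to
    [t u (e m) = t ((u e) m)], uniformly for [|e| <= 1], and the latter tends to [t (u m)]. *)
Lemma rmult_cvg s (t : arrow r s) :
  t \oc multR m e @[e --> approximate_unit r] --> rmult t m.
Proof.
have [_ [lR cR] _ RM _] := multiplier_props; have [K K0 RK] := multR_bounded.
apply: rcauchy_cvg => d d0; have d2 : 0 < d / 2 by rewrite divr_gt0.
have /rcvgP/(_ _ (divr_gt0 d2 K0)) := acomp_approximate_unit t.
move=> /filter_ex[u]; rewrite ltr_pdivlMr// => tu; exists (t \oc multR m u).
have /rcvgP/(_ _ d2) : t \oc multR m (u \oc e) @[e --> approximate_unit r] --> t \oc multR m u.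
  by apply: acomp_cvgr; exact: cvg_comp (acomp_approximate_unit u) (cR u).
move=> h; apply: filterS2 h (approximate_unit_le1 r) => e te e1 /=.
rewrite (le_lt_trans (ler_rnorm_dist (t \oc multR m (u \oc e)) _ _))//.
rewrite [X in _ + rnorm X](_ : _ = - ((t - t \oc u) \oc multR m e)).
  rewrite rnormN; have := rnorm_acomp (t - t \oc u) (multR m e).
  by have := RK _ e1; have := rnorm_ge0 (t - t \oc u); nra.
by rewrite RM; acomp_expand; lmodule.
Qed.

Arguments rmult_cvg {s} t.

(** Passing to the limit in [(t (e m)) a = t e (m a)]. Together with [acomp_cancelr] this reduces
    identities for arrows to identities in [arrow r r]. *)
Lemma rmult_acomp s (t : arrow r s) a : rmult t m \oc a = t \oc multL m a.
Proof.
have [_ _ _ _ LR] := multiplier_props.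
have h1 := acomp_cvgl (b := a) (rmult_cvg t).
have h2 : t \oc e \oc multL m a @[e --> approximate_unit r] --> t \oc multL m a.
  exact: (acomp_cvgl (b := multL m a) (acomp_approximate_unit t)).
have E : (fun e => t \oc e \oc multL m a) = (fun e => t \oc multR m e \oc a).
  by apply/funext => e; rewrite -!acompA LR.
rewrite E in h2; exact: (cvg_unique (@norm_hausdorff _ (arrow r s)) (h1 _) h2).
Qed.

Lemma rmult_multR (a : arrow r r) : rmult a m = multR m a.
Proof.
have [_ [_ cR] _ RM _] := multiplier_props; apply: cvg_lim; first exact: norm_hausdorff.
under eq_fun do rewrite -RM.
exact: cvg_comp (acomp_approximate_unit a) (cR a).
Qed.

Lemma lmult_multL (a : arrow r r) : lmult m a = multL m a.
Proof.
have [[_ cL] _ LM _ _] := multiplier_props; apply: cvg_lim; first exact: norm_hausdorff.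
under eq_fun do rewrite -LM.
have [_ _ h _] := @approximate_unitP R C r; exact: cvg_comp (h a) (cL a).
Qed.

End Multipliers.

(** If [v] annihilates everything on its right, then so does it [v^# v], and
    [|v|^4 = |(v^# v)^# (v^# v)| = 0]. *)
Lemma acomp_cancelr (R : realType) (C : CstarCategory R) (r s : C) (t u : arrow r s) :
  (forall a : arrow r r, t \oc a = u \oc a) -> t = u.
Proof.
move=> tu; apply: subr0_eq; apply: rnorm_eq0; set v := t - u.
have v0 (a : arrow r r) : v \oc a = 0 by rewrite acompBl tu subrr.
have : rnorm ((v^# \oc v)^# \oc (v^# \oc v)) = 0.
  by rewrite astar_comp astarK -!acompA [v \oc (_ \oc v)]v0 acomp0r rnorm0.
rewrite !rnorm_cstar => /eqP; rewrite !expf_eq0/= => /eqP ->.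
exact: lexx.
Qed.

Lemma C0_ext (R : realType) (X : topologicalType) (f g : C0 R X) :
  (forall x, f x = g x) -> f = g.
Proof. by move=> fg; apply: val_inj; apply/funext. Qed.

(** * The module structure over [C0 R X] on spaces of arrows *)

Section Action.
Context {R : realType} {X : topologicalType} {C : C0Category R X}.
Implicit Types (r s u : C) (f g : C0 R X) (k : R[i]).

Lemma C0_act_multL r f (a : arrow r r) : C0_act f a = multL (C0map C r f) a.
Proof. by rewrite /C0_act C0map_central lmult_multL. Qed.

Lemma C0_act_acompl r s f (t : arrow r s) (a : arrow r r) :
  C0_act f t \oc a = t \oc C0_act f a.
Proof. by rewrite C0_act_multL [LHS]rmult_acomp. Qed.

Lemma C0_act_acomp r s u f (v : arrow s u) (t : arrow r s) :
  C0_act f (v \oc t) = v \oc C0_act f t.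
Proof.
by apply: acomp_cancelr => a; rewrite -acompA !C0_act_acompl acompA.
Qed.

Lemma C0_actDr r s f (t v : arrow r s) : C0_act f (t + v) = C0_act f t + C0_act f v.
Proof. by apply: acomp_cancelr => a; rewrite acompDl !C0_act_acompl acompDl. Qed.

Lemma C0_actZr r s f k (t : arrow r s) : C0_act f (k *: t) = k *: C0_act f t.
Proof. by apply: acomp_cancelr => a; rewrite acompZl !C0_act_acompl acompZl. Qed.

Lemma C0map_linear r f g k (a : arrow r r) :
  C0_act (k *: f + g) a = k *: C0_act f a + C0_act g a.
Proof.
by rewrite !C0_act_multL; have [-> _ _] := @C0map_morphism _ _ C r.
Qed.

Lemma C0_act_linear r s f g k (t : arrow r s) :
  C0_act (k *: f + g) t = k *: C0_act f t + C0_act g t.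
Proof.
apply: acomp_cancelr => a; rewrite acompDl acompZl !C0_act_acompl C0map_linear.
by rewrite acompDr acompZr.
Qed.

Lemma C0_actM r s f g (t : arrow r s) : C0_act (C0_mul f g) t = C0_act f (C0_act g t).
Proof.
apply: acomp_cancelr => a; rewrite !C0_act_acompl -C0_act_acomp.
(* Moving the two actions onto the right factor reverses their order, so commutativity of [C0_mul]
   enters. *)
have -> : C0_mul f g = C0_mul g f by apply: C0_ext => x; rewrite /= mulrC.
rewrite C0_act_acomp; congr (_ \oc _).
by rewrite !C0_act_multL; have [_ -> _] := @C0map_morphism _ _ C r.
Qed.

(** [mult_star] exchanges [multL] and [multR], and by centrality both describe the action on
    [arrow r r]. *)
Lemma C0_actJ r f (a : arrow r r) : (C0_act f a)^# = C0_act (C0_conj f) a^#.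
Proof.
rewrite [RHS]C0_act_multL; have [_ _ ->] := @C0map_morphism _ _ C r.
by rewrite /C0_act rmult_multR /multL/= astarK.
Qed.

Lemma C0_act_cstarl r s f (t : arrow r s) :
  (C0_act f t)^# \oc t = C0_act (C0_conj f) (t^# \oc t).
Proof.
by rewrite -{2}[t]astarK -astar_comp -C0_act_acomp C0_actJ astar_comp astarK.
Qed.

Lemma C0_act_cstar r s f g (t : arrow r s) :
  (C0_act f t)^# \oc C0_act g t = C0_act (C0_mul (C0_conj f) g) (t^# \oc t).
Proof.
have -> : C0_mul (C0_conj f) g = C0_mul g (C0_conj f).
  by apply: C0_ext => x; rewrite /= mulrC.
by rewrite C0_actM -C0_act_acomp C0_act_cstarl.
Qed.

Lemma C0_actDl r s f g (t : arrow r s) : C0_act (f + g) t = C0_act f t + C0_act g t.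
Proof. by have := C0_act_linear f g 1 t; rewrite !scale1r. Qed.

Lemma C0_act0l r s (t : arrow r s) : C0_act (0 : C0 R X) t = 0.
Proof. by apply: (@addrI _ (C0_act 0 t)); rewrite -C0_actDl !addr0. Qed.

Lemma C0_actZl r s f k (t : arrow r s) : C0_act (k *: f) t = k *: C0_act f t.
Proof. by have := C0_act_linear f 0 k t; rewrite C0_act0l !addr0. Qed.

Lemma C0_actBl r s f g (t : arrow r s) : C0_act (f - g) t = C0_act f t - C0_act g t.
Proof. by rewrite -scaleN1r C0_actDl C0_actZl scaleN1r. Qed.

Lemma C0_actBr r s f (t v : arrow r s) : C0_act f (t - v) = C0_act f t - C0_act f v.
Proof. by rewrite -scaleN1r C0_actDr C0_actZr scaleN1r. Qed.

Lemma C0_act_suml r s I (P : seq I) (f : I -> C0 R X) (t : arrow r s) :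
  C0_act (\sum_(i <- P) f i) t = \sum_(i <- P) C0_act (f i) t.
Proof.
by elim/big_ind2: _ => [|x y z v <- <-|//]; rewrite ?C0_act0l ?C0_actDl.
Qed.

Lemma C0_act_sumr r s I (P : seq I) f (t : I -> arrow r s) :
  C0_act f (\sum_(i <- P) t i) = \sum_(i <- P) C0_act f (t i).
Proof.
elim/big_ind2: _ => [|x y z v <- <-|//]; last by rewrite C0_actDr.
by have := C0_actZr f 0 (0 : arrow r s); rewrite !scale0r.
Qed.

End Action.

(** * Real-valued functions and absolute values in [C0 R X] *)

Section C0Functions.
Context {R : realType} {X : topologicalType}.
Implicit Types (f g : C0 R X) (p : X -> R).

Lemma C0_near f x (e : R) : 0 < e -> \forall y \near x, rnorm (f x - f y) < e.
Proof.
by move=> e0; have /C0_predP[cf _] := C0_funP f; have /rcvgP/(_ _ e0) := cf x.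
Qed.

Lemma C0_vanish f (e : R) : 0 < e ->
  exists2 K : set X, compact K & forall x, ~ K x -> rnorm (f x) < e.
Proof.
move=> e0; have /C0_predP[_ vf] := C0_funP f.
have e0' : 0 < e%:C :> R[i] by rewrite ltcR.
by have [K cK fK] := vf _ e0'; exists K => // x /fK; rewrite rnormE ltcR.
Qed.

Lemma C0_of_real p : continuous p ->
  (forall e, 0 < e -> exists2 K : set X, compact K & forall x, ~ K x -> `|p x| < e) ->
  exists f : C0 R X, forall x, f x = (p x)%:C.
Proof.
move=> cp vp; have fp : (fun x => (p x)%:C) \in @C0_pred R X.
  apply/C0_predP; split=> [x|e /gt0_realE[-> e0]].
    apply/rcvgP => e e0; have /cvgrPdist_lt/(_ _ e0) := cp x.
    by apply: filterS => y; rewrite -rmorphB rnormC.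
  by have [K cK pK] := vp _ e0; exists K => // x /pK; rewrite rnormE rnormC ltcR.
by exists (MkC0 fp).
Qed.

Lemma C0_real_continuous f p : (forall x, f x = (p x)%:C) -> continuous p.
Proof.
move=> fp x; apply/cvgrPdist_lt => e e0.
by apply: filterS (C0_near f x e0) => y; rewrite !fp -rmorphB rnormC.
Qed.

Lemma C0_real_vanish f p : (forall x, f x = (p x)%:C) -> forall e, 0 < e ->
  exists2 K : set X, compact K & forall x, ~ K x -> `|p x| < e.
Proof.
move=> fp e e0; have [K cK fK] := C0_vanish f e0.
by exists K => // x /fK; rewrite fp rnormC.
Qed.

Lemma C0_abs f : exists g : C0 R X, forall x, g x = (rnorm (f x))%:C.
Proof.
apply: C0_of_real => [x|e /C0_vanish-/(_ f)[K cK fK]].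
  apply/cvgrPdist_lt => e e0; apply: filterS (C0_near f x e0) => y.
  apply: le_lt_trans; have := ler_rnorm_sub (f x) (f y).
  have := ler_rnorm_sub (f y) (f x); rewrite [rnorm (f y - _)]rnormB ler_norml; lra.
by exists K => // x /fK; rewrite ger0_norm ?rnorm_ge0.
Qed.

Lemma C0_sumE (I : Type) (s : seq I) (f : I -> C0 R X) x :
  (\sum_(i <- s) f i) x = \sum_(i <- s) f i x.
Proof. by elim/big_rec2: _ => // i y g _ <-. Qed.

End C0Functions.

(** * Norm estimates for the action *)

Section Contractivity.
Context {R : realType} {X : topologicalType} {C : C0Category R X}.
Implicit Types (r s u : C) (f g h : C0 R X) (k : R[i]) (p q : X -> R).

(** The hypotheses say [|k + g x|^2 = 1], expanded so that the constant [k] stays outside [C0 R X];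
    the C*-identity then shows that [k + g] acts isometrically. *)
Lemma C0_act_unitary r s k g (t : arrow r s) : conjc k * k = 1 ->
  (forall x, conjc k * g x + k * conjc (g x) + conjc (g x) * g x = 0) ->
  rnorm (k *: t + C0_act g t) = rnorm t.
Proof.
move=> k1 kg; apply/eqP; rewrite -(@eqrXn2 _ 2)// ?rnorm_ge0//.
rewrite -!rnorm_cstar astarD astarZ acompDl !acompDr acompZl acompZr.
rewrite [in X in _ + X]acompZr [in X in X + _]acompZl -C0_act_acomp C0_act_cstar.
rewrite C0_act_cstarl scalerA k1 scale1r -C0_actZl -C0_actZl -addrA -!C0_actDl.
rewrite [X in C0_act X](_ : _ = 0) ?C0_act0l ?addr0//.
by apply: C0_ext => x; rewrite /= -[RHS](kg x) addrA.
Qed.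

(* [p + i sqrt (1 - p^2)] is unitary and differs from [i] by an element of
   [C_0(X)], so [f] acts as the mean of two isometries. *)
Lemma C0_act_contraction_real r s f p (t : arrow r s) :
  (forall x, f x = (p x)%:C) -> (forall x, `|p x| <= 1) ->
  rnorm (C0_act f t) <= rnorm t.
Proof.
(* Subtracting 1 makes the function vanish at infinity: [p + i sqrt (1 - p^2) = i + (p + i q)]. *)
move=> fp p1; pose q x := Num.sqrt (1 - p x ^+ 2) - 1.
have p21 x : 0 <= 1 - p x ^+ 2 by rewrite subr_ge0 -real_normK ?num_real// expr_le1.
have [f0 f0q] : exists f0 : C0 R X, forall x, f0 x = (q x)%:C.
  apply: C0_of_real => [x|e e0].
    rewrite /q; apply: cvgB; last exact: cvg_cst.
    apply: (@continuous_comp _ _ _ (fun x => 1 - p x ^+ 2) Num.sqrt); last exact: sqrt_continuous.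
    apply: cvgB; first exact: cvg_cst.
    apply: (@continuous_comp _ _ _ p (fun y => y ^+ 2)); last exact: exprn_continuous.
    exact: (C0_real_continuous fp).
  have [K cK pK] := C0_real_vanish fp e0; exists K => // x /pK.
  (* [|q x| <= |p x|], since [1 - |p x| <= sqrt (1 - p x ^+ 2)]. *)
  apply: le_lt_trans; rewrite /q.
  have s0 := sqrtr_ge0 (1 - p x ^+ 2); have s2 := sqr_sqrtr (p21 x).
  have := p1 x; move: (Num.sqrt _) s0 s2 => y y0 y2.
  rewrite !ler_norml => /andP[p1l p1r]; apply/andP; split.
    have [|] := leP 0 (p x) => ?; [rewrite ger0_norm//; nra|rewrite ltr0_norm//; nra].
  have [|] := leP 0 (p x) => ?; [rewrite ger0_norm//; nra|rewrite ltr0_norm//; nra].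
(* ['i + g] and [- 'i + g'] are complex conjugate unimodular functions with sum [2 f]. *)
pose g := f + 'i *: f0; pose g' := f - 'i *: f0.
have q0 x : q x ^+ 2 + 2 * q x + p x ^+ 2 = 0.
  have := sqr_sqrtr (p21 x); rewrite /q; nra.
have ii : conjc 'i * 'i = 1 :> R[i].
  by apply/eqP; rewrite eq_complex/=; apply/andP; split; apply/eqP; ring.
have U1 : rnorm ('i *: t + C0_act g t) = rnorm t.
  apply: C0_act_unitary => // x.
  rewrite /= !fctE fp f0q; apply/eqP; rewrite eq_complex; apply/andP; split; apply/eqP => /=; last ring.
  rewrite -[RHS](q0 x); ring.
have U2 : rnorm (- 'i *: t + C0_act g' t) = rnorm t.
  apply: C0_act_unitary => [|x]; first by rewrite rmorphN mulrNN.
  rewrite /= !fctE fp f0q; apply/eqP; rewrite eq_complex; apply/andP; split; apply/eqP => /=; last ring.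
  rewrite -[RHS](q0 x); ring.
have E : 2%:C *: C0_act f t = ('i *: t + C0_act g t) + (- 'i *: t + C0_act g' t).
  rewrite /g /g' C0_actDl C0_actBl C0_actZl (rmorph_nat (real_complex R)).
  by lmodule.
have := ler_rnormD ('i *: t + C0_act g t) (- 'i *: t + C0_act g' t).
rewrite -E rnormZr U1 U2 ger0_norm//; lra.
Qed.

(** The C*-identity replaces [f] by the real function [|f|^2] acting on [t^# t]. *)
Lemma C0_act_contraction r s f (t : arrow r s) :
  (forall x, rnorm (f x) <= 1) -> rnorm (C0_act f t) <= rnorm t.
Proof.
move=> f1; rewrite -(@ler_pXn2r _ 2)// ?nnegrE ?rnorm_ge0// -!rnorm_cstar C0_act_cstar.
apply: (@C0_act_contraction_real _ _ _ (fun x => rnorm (f x) ^+ 2)) => x.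
  by rewrite /= mulrC rmorphXn/= -rnormE -[LHS]sqr_normc.
by rewrite ger0_norm ?exprn_ge0 ?rnorm_ge0// exprn_ile1// rnorm_ge0.
Qed.

Lemma C0_act_bound r s f (M : R) (t : arrow r s) : 0 < M ->
  (forall x, rnorm (f x) <= M) -> rnorm (C0_act f t) <= M * rnorm t.
Proof.
move=> M0 fM; have -> : f = M%:C *: (M^-1%:C *: f).
  by rewrite scalerA -rmorphM/= mulfV ?gt_eqF// rmorph1 scale1r.
rewrite C0_actZl rnormZr gtr0_norm// ler_pM2l//.
apply: C0_act_contraction => x.
rewrite [X in rnorm X](_ : _ = M^-1%:C *: f x)// rnormZr gtr0_norm ?invr_gt0// mulrC.
by rewrite ler_pdivrMr// mul1r.
Qed.

(** Up to a small error [f] is a multiple of [g]: with [h = p / (q + d)], which acts contractively,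
    [f - h g = p d / (q + d)] is at most [d]. *)
Lemma C0_act_le r s f g p q (t : arrow r s) :
  (forall x, f x = (p x)%:C) -> (forall x, g x = (q x)%:C) ->
  (forall x, 0 <= p x <= q x) -> rnorm (C0_act f t) <= rnorm (C0_act g t).
Proof.
move=> fp gq pq; apply/ler_addgt0Pr => e e0.
have t0 : 0 < rnorm t + 1 by have := rnorm_ge0 t; lra.
pose d := e / (rnorm t + 1); have d0 : 0 < d by rewrite divr_gt0.
have dt : d * (rnorm t + 1) = e by rewrite divfK// gt_eqF.
have qd x : 0 < q x + d by have := pq x; lra.
have [h hE] : exists h : C0 R X, forall x, h x = (p x / (q x + d))%:C.
  apply: C0_of_real => [x|k k0].
    apply: cvgM; first exact: (C0_real_continuous fp).
    apply: cvgV; first by rewrite gt_eqF.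
    by apply: cvgD; [exact: (C0_real_continuous gq)|exact: cvg_cst].
  have [K cK pK] := C0_real_vanish fp (mulr_gt0 k0 d0); exists K => // x /pK.
  have := qd x; have /andP[p0 pqx] := pq x; rewrite !ger0_norm ?divr_ge0//; last exact: ltW.
  rewrite ltr_pdivrMr//; nra.
have -> : f = C0_mul h g + (f - C0_mul h g) by rewrite addrC subrK.
rewrite C0_actDl C0_actM (le_trans (ler_rnormD _ _))// lerD//.
  apply: C0_act_contraction => x; rewrite hE rnormC.
  have := qd x; have /andP[p0 pqx] := pq x; rewrite ger0_norm ?divr_ge0//; last exact: ltW.
  rewrite ler_pdivrMr//; lra.
apply: (@le_trans _ _ (d * rnorm t)); last by rewrite -dt ler_pM2l// lerDl.
apply: C0_act_bound => // x.
have -> : (f - C0_mul h g) x = (p x - p x / (q x + d) * q x)%:C.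
  by rewrite rmorphB rmorphM/= -hE -gq -fp.
rewrite rnormC; have -> : p x - p x / (q x + d) * q x = p x * d / (q x + d).
  by field; rewrite gt_eqF.
have /andP[p0 pqx] := pq x; have qx := qd x.
rewrite ger0_norm; last by apply: divr_ge0; [apply: mulr_ge0 => //; exact: ltW|exact: ltW].
by rewrite ler_pdivrMr//; nra.
Qed.

End Contractivity.

(** * Powers, finite covers and cutoff functions *)

Lemma bernoulli_inequality (R : realDomainType) (a : R) (n : nat) : 0 <= a -> 1 + a *+ n <= (1 + a) ^+ n.
Proof.
move=> a0; elim: n => [|n IH]; first by rewrite mulr0n addr0 expr0.
rewrite exprS mulrSr; apply: le_trans (ler_wpM2l _ IH); last lra.
have : 0 <= a *+ n by rewrite mulrn_wge0.
nra.
Qed.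

(** If [x > c], then by Bernoulli the powers of [x / c] outgrow the fixed constant [N]. *)
Lemma expr_pow2_bounded (R : realType) (x c N : R) : 0 <= x -> 0 < c ->
  (forall k, x ^+ (2 ^ k) <= N * c ^+ (2 ^ k)) -> x <= c.
Proof.
move=> x0 c0 xN; rewrite leNgt; apply/negP => cx.
pose a := x / c - 1; have a0 : 0 < a by rewrite subr_gt0 ltr_pdivlMr// mul1r.
have aN k : a *+ 2 ^ k <= N.
  have : (1 + a) ^+ (2 ^ k) <= N.
    by rewrite /a addrC subrK expr_div_n ler_pdivrMr ?exprn_gt0.
  have := bernoulli_inequality (2 ^ k) (ltW a0); lra.
have N0 : 0 <= N / a by rewrite divr_ge0 ?(le_trans _ (aN 0))// ltW.
have := archi_boundP N0; set n := Num.bound _; rewrite ltr_pdivrMr// => Nn.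
have := aN n; have : a *+ n <= a *+ 2 ^ n by rewrite ler_pMn2l// ltnW// ltn_expl.
by move: Nn; rewrite mulr_natl; lra.
Qed.

Section Cover.
Context {R : realType} {X : topologicalType} {C : C0Category R X}.
Implicit Types (r s u : C) (f g h : C0 R X) (p q : X -> R).

(** Iterates [|f b|^2 = |f^2 b^2|]. The arrow [c] is given explicitly in terms of [b] and [k], so
    that the powers of different functions act on the same arrow. *)
Lemma C0_act_power r f p (b : arrow r r) k :
  (forall x, f x = (p x)%:C) -> b^# = b ->
  exists g (c : arrow r r), [/\ forall x, g x = (p x ^+ (2 ^ k))%:C ,
    c = iter k (fun a => a \oc a) b & rnorm (C0_act f b) ^+ (2 ^ k) = rnorm (C0_act g c)].
Proof.
elim: k f p b => [|k IH] f p b fp sb; first by exists f, b.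
have fJ : C0_conj f = f by apply: C0_ext => x; rewrite /= fp conjc_real.
have ff x : C0_mul f f x = (p x ^+ 2)%:C by rewrite /= fp -rmorphM.
have sbb : (b \oc b)^# = b \oc b by rewrite astar_comp sb.
have [g [c [gE cE h]]] := IH _ _ _ ff sbb; exists g, c; split=> [x||].
- by rewrite gE expnS exprM.
- by rewrite cE iterSr.
- rewrite expnS exprM -h -rnorm_cstar C0_actJ fJ sb -C0_act_acomp C0_act_acompl.
  by rewrite -C0_act_acomp -C0_actM.
Qed.

(** High powers replace a maximum by a sum: [p^n <= sum_i q_i^n] pointwise, and the resulting factor
    [size S] is independent of [n], so [expr_pow2_bounded] removes it. *)
Lemma C0_act_cover r s f p (I : eqType) (S : seq I) (h : I -> C0 R X) (q : I -> X -> R)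
    (c : R) (t : arrow r s) :
  (forall x, f x = (p x)%:C) -> (forall x, 0 <= p x) ->
  (forall i x, h i x = (q i x)%:C) -> (forall i x, 0 <= q i x) ->
  (forall x, p x != 0 -> exists2 i, i \in S & p x <= q i x) ->
  0 < c -> (forall i, i \in S -> rnorm (C0_act (h i) t) <= c) ->
  rnorm (C0_act f t) <= c.
Proof.
move=> fp p0 hq q0 pq c0 hc; set b := t^# \oc t.
have sb : b^# = b by rewrite astar_comp astarK.
have sqE g w : (forall x, g x = (w x)%:C) ->
    (forall x, C0_mul g g x = (w x ^+ 2)%:C) /\
    rnorm (C0_act g t) ^+ 2 = rnorm (C0_act (C0_mul g g) b).
  move=> gw; split=> [x|]; first by rewrite /= gw -rmorphM.
  have gJ : C0_conj g = g by apply: C0_ext => x; rewrite /= gw conjc_real.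
  by rewrite -rnorm_cstar C0_act_cstar gJ.
rewrite -(@ler_pXn2r _ 2)// ?nnegrE ?rnorm_ge0//; last exact: ltW.
have [ffp ->] := sqE _ _ fp.
apply: (@expr_pow2_bounded _ _ _ (size S)%:R); rewrite ?rnorm_ge0 ?exprn_gt0// => k.
have [F [bk [FE bkE ->]]] := C0_act_power k ffp sb.
have /boolp.choice[H HE] : forall i, exists g, (forall x, g x = ((q i x ^+ 2) ^+ (2 ^ k))%:C) /\
    (rnorm (C0_act (h i) t) ^+ 2) ^+ (2 ^ k) = rnorm (C0_act g bk).
  move=> i; have [hh ->] := sqE _ _ (hq i).
  have [g [c' [gE c'E ->]]] := C0_act_power k hh sb.
  by exists g; split=> //; rewrite bkE -c'E.
pose G := \sum_(i <- S) H i.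
have GE x : G x = (\sum_(i <- S) (q i x ^+ 2) ^+ (2 ^ k))%:C.
  rewrite /G C0_sumE rmorph_sum; apply: eq_bigr => i _.
  by have [-> _] := HE i.
have q4 i x : 0 <= (q i x ^+ 2) ^+ (2 ^ k) by rewrite !exprn_ge0.
apply: (@le_trans _ _ (rnorm (C0_act G bk))).
  apply: (C0_act_le _ FE GE) => x; rewrite !exprn_ge0//=.
  have [->|/pq[i iS pqi]] := eqVneq (p x) 0.
    by rewrite expr0n/= expr0n expn_eq0/= sumr_ge0.
  rewrite (big_rem i)//= -[leLHS]addr0 lerD//; last by apply: sumr_ge0.
  by rewrite !lerXn2r ?nnegrE ?exprn_ge0.
rewrite /G C0_act_suml (le_trans (ler_rnorm_sum _ _ _))// big_seq.
rewrite (@le_trans _ _ (\sum_(i <- S | i \in S) (c ^+ 2) ^+ (2 ^ k)))//.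
  apply: ler_sum => i /hc ic; have [_ <-] := HE i.
  by rewrite !lerXn2r ?nnegrE ?exprn_ge0 ?rnorm_ge0// ltW.
by rewrite -big_seq big_const_seq count_predT iter_addr_0 mulr_natl.
Qed.

(* Functions [p] that cut off the small values of [sum_i |f_i|] act almost
   trivially on [sum_i f_i a_i]. *)
Lemma C0_cutoff (n : nat) (f : 'I_n -> C0 R X) (d : R) : 0 < d ->
  exists g p, [/\ forall x, g x = (p x)%:C, forall x, 0 <= p x <= 1,
    (exists2 K : set X, compact K & forall x, ~ K x -> p x = 0) &
    forall i x, rnorm ((f i - C0_mul g (f i)) x) <= d].
Proof.
move=> d0; have /boolp.choice[h hE] i := C0_abs (f i).
pose P := \sum_i h i; pose w x := \sum_i rnorm (f i x).
have PE x : P x = (w x)%:C.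
  by rewrite /P C0_sumE rmorph_sum; apply: eq_bigr => i _; rewrite hE.
have d2 : 0 < d / 2 by rewrite divr_gt0.
(* [p] is 0 where [w <= d / 2] and 1 where [w >= d]; elsewhere [|f_i| <= w < d] already. *)
pose p := (fun=> 1) \min ((fun=> 0) \max (fun x => w x / (d / 2) - 1)).
have p01 x : 0 <= p x <= 1 by rewrite /p/= le_min le_max ge_min !lexx ler01.
have [K cK wK] := C0_real_vanish PE d2.
have pK x : ~ K x -> p x = 0.
  move=> /wK; rewrite ger0_norm ?sumr_ge0// => [wx|i _]; last exact: rnorm_ge0.
  by rewrite /p/= max_l ?min_r// subr_le0 ler_pdivrMr// mul1r ltW.
have [g gp] : exists g : C0 R X, forall x, g x = (p x)%:C.
  apply: C0_of_real => [x|e e0]; last first.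
    by exists K => // x /pK ->; rewrite normr0.
  apply: (@continuous_min _ _ (fun=> 1)); first exact: cvg_cst.
  apply: (@continuous_max _ _ (fun=> 0)); first exact: cvg_cst.
  apply: cvgB; last exact: cvg_cst.
  apply: cvgM; last exact: cvg_cst.
  exact: (C0_real_continuous PE).
exists g, p; split=> //; first by exists K.
move=> i x; have fw : rnorm (f i x) <= w x.
  by rewrite /w (bigD1 i)//= lerDl sumr_ge0// => j _; exact: rnorm_ge0.
have -> : (f i - C0_mul g (f i)) x = (1 - p x)%:C *: f i x.
  by rewrite rmorphB rmorph1 /= scalerBl scale1r -gp.
rewrite rnormZr; have := p01 x; have := rnorm_ge0 (f i x).
have [wd|wd] := leP d (w x).
  have y1 : 1 <= w x / (d / 2) - 1 by rewrite lerBrDr ler_pdivlMr//; lra.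
  have p1 : p x = 1 by rewrite /p/= max_r ?min_l// (le_trans ler01).
  by rewrite p1 subrr normr0 mul0r => *; exact: ltW.
move=> f0 /andP[p0 p1]; rewrite ger0_norm; last lra.
nra.
Qed.

End Cover.

(** * Approximation of arrows by compactly supported cutoffs *)

Section Nondegeneracy.
Context {R : realType} {X : topologicalType} {C : C0Category R X}.
Implicit Types (r s u : C) (f g h : C0 R X) (p q : X -> R).

Lemma linear_span_image2 (V W : normedModType R[i]) (T : Type) (P : set T)
    (F : T -> W -> V) (v : V) :
  linear_span [set F f b | f in P & b in [set: W]] v ->
  exists n (c : 'I_n -> R[i]) (f : 'I_n -> T) (b : 'I_n -> W),
    (forall i, P (f i)) /\ v = \sum_(i < n) c i *: F (f i) (b i).
Proof.
move=> [n [c [u [Su ->]]]].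
have /boolp.choice[fb fbE] : forall i, exists fb : T * W, P fb.1 /\ F fb.1 fb.2 = u i.
  by move=> i; have [f Pf [b _ <-]] := Su i; exists (f, b).
exists n, c, (fun i => (fb i).1), (fun i => (fb i).2); split.
  by move=> i; have [] := fbE i.
by apply: eq_bigr => i _; have [_ ->] := fbE i.
Qed.

Lemma C0_act_sum_bound r s n (c : 'I_n -> R[i]) (f : 'I_n -> C0 R X)
    (b : 'I_n -> arrow r s) (d e : R) : 0 < e ->
  d = e / (\sum_i rnorm (c i) * rnorm (b i) + 1) ->
  (forall i x, rnorm (f i x) <= d) ->
  rnorm (\sum_i c i *: C0_act (f i) (b i)) < e.
Proof.
move=> e0 dE fd; set M := \sum_i _ in dE.
have M0 : 0 <= M by apply: sumr_ge0 => i _; rewrite mulr_ge0 ?rnorm_ge0.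
have d0 : 0 < d by rewrite dE divr_gt0//; lra.
have dM : d * (M + 1) = e by rewrite dE divfK// gt_eqF//; lra.
apply: (@le_lt_trans _ _ (d * M)); last by rewrite -dM ltr_pM2l//; lra.
rewrite (le_trans (ler_rnorm_sum _ _ _))// mulr_sumr ler_sum// => i _.
rewrite rnormZ [leRHS]mulrCA ler_wpM2l ?rnorm_ge0//.
by apply: C0_act_bound.
Qed.

(** Nondegeneracy puts a finite sum [u] of elements [f_i b_i] near [a]. A cutoff adapted to the
    [f_i] nearly fixes [u] and does not enlarge [a - u]. *)
Lemma C0_approximate_algebra r (a : arrow r r) (e : R) : 0 < e ->
  exists g p, [/\ forall x, g x = (p x)%:C, forall x, 0 <= p x <= 1,
    (exists2 K : set X, compact K & forall x, ~ K x -> p x = 0) &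
    rnorm (a - C0_act g a) < e].
Proof.
move=> e0; have e3 : 0 < e / 3 by rewrite divr_gt0.
have : closure (linear_span [set multL (C0map C r f) a | f in setT & a in setT]) a.
  by rewrite (@C0map_nondegenerate _ _ C r).
move=> /rclosureP/(_ _ e3)[u /linear_span_image2[n [c [f [b [_ uE]]]]] au].
set d := e / 3 / (\sum_i rnorm (c i) * rnorm (b i) + 1).
have d0 : 0 < d.
  rewrite divr_gt0// ltr_wpDl// sumr_ge0// => i _.
  by rewrite mulr_ge0 ?rnorm_ge0.
have [g [p [gp p01 pK fd]]] := C0_cutoff f d0.
exists g, p; split=> //.
have guE : u - C0_act g u = \sum_i c i *: C0_act (f i - C0_mul g (f i)) (b i).
  rewrite uE C0_act_sumr -sumrB; apply: eq_bigr => i _.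
  by rewrite C0_actZr -scalerBr C0_actBl C0_actM -!C0_act_multL.
have gu := C0_act_sum_bound e3 erefl fd.
have ga : rnorm (C0_act g (a - u)) <= rnorm (a - u).
  apply: C0_act_contraction => x; rewrite gp rnormC.
  by have /andP[p0 p1] := p01 x; rewrite ger0_norm.
have -> : a - C0_act g a = (a - u) + (u - C0_act g u) - C0_act g (a - u).
  by rewrite C0_actBr; lmodule.
rewrite -guE in gu; have := ler_rnormB (a - u + (u - C0_act g u)) (C0_act g (a - u)).
have := ler_rnormD (a - u) (u - C0_act g u); lra.
Qed.

(** [t] is close to some [t v] with [v] in [arrow r r], and [g (t v) = t (g v)] reduces the claim to
    [v]. *)
Lemma C0_approximate r s (t : arrow r s) (e : R) : 0 < e ->
  exists g p, [/\ forall x, g x = (p x)%:C, forall x, 0 <= p x <= 1,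
    (exists2 K : set X, compact K & forall x, ~ K x -> p x = 0) &
    rnorm (t - C0_act g t) < e].
Proof.
move=> e0; have e3 : 0 < e / 3 by rewrite divr_gt0.
have t0 : 0 < rnorm t + 1 by have := rnorm_ge0 t; lra.
have /rcvgP/(_ _ e3) := @acomp_approximate_unit _ _ _ _ t.
move=> /filter_ex[v tv].
have [g [p [gp p01 pK gv]]] := C0_approximate_algebra v (divr_gt0 e3 t0).
exists g, p; split=> //.
have ga : rnorm (C0_act g (t - t \oc v)) <= rnorm (t - t \oc v).
  apply: C0_act_contraction => x; rewrite gp rnormC.
  by have /andP[p0 p1] := p01 x; rewrite ger0_norm.
have -> : t - C0_act g t =
    (t - t \oc v) + t \oc (v - C0_act g v) - C0_act g (t - t \oc v).
  by rewrite C0_actBr C0_act_acomp acompBr; lmodule.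
have := ler_rnormB (t - t \oc v + t \oc (v - C0_act g v)) (C0_act g (t - t \oc v)).
have := ler_rnormD (t - t \oc v) (t \oc (v - C0_act g v)).
have := rnorm_acomp t (v - C0_act g v); have := rnorm_ge0 (v - C0_act g v).
have := rnorm_ge0 t; move: gv; rewrite ltr_pdivlMr//; nra.
Qed.

Lemma C0_bounded f : exists2 M : R, 0 < M & forall x, rnorm (f x) <= M.
Proof.
have [h hE] := C0_abs f; have [K cK hK] := C0_real_vanish hE ltr01.
have cf : {within K, continuous (fun x => rnorm (f x))}.
  exact/continuous_subspaceT/(C0_real_continuous hE).
have /compact_bounded[M [_ KM]] := continuous_compact cf cK.
exists (`|M| + 1); first by rewrite ltr_wpDl.
move=> x; have [Kx|/hK] := pselect (K x).
  have := KM (`|M| + 1); rewrite (le_lt_trans (ler_norm M)) ?ltrDl// => /(_ isT).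
  by move=> /(_ (rnorm (f x))); rewrite /= ger0_norm ?rnorm_ge0//; apply; exists x.
rewrite ger0_norm ?rnorm_ge0// => fx; have := normr_ge0 M; lra.
Qed.

End Nondegeneracy.

(** * Localization of the norm at a point *)

Lemma compact_finite_cover (X : topologicalType) (K : set X) (P : X -> set X) :
  compact K -> (forall x, K x -> nbhs x (P x)) ->
  exists D : seq X, forall y, K y -> exists2 x, x \in D & P x y.
Proof.
move=> /compact_near_coveringP cK KP.
(* Lists directed by inclusion; near this filter the list contains any given finite set of
   points. *)
pose F : set_system (seq X) := filter_from setT (fun D : seq X => [set E : seq X | {subset D <= E}]).
have FF : ProperFilter F.
  apply: filter_from_proper => [|D _]; last by exists D => /=.
  apply: filter_from_filter => [|D E _ _]; first by exists [::].
  exists (D ++ E) => // G DEG; split=> x xD; apply: DEG; rewrite mem_cat xD ?orbT//.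
have KF : \forall D \near F, K `<=` [set y | exists2 x, x \in D & P x y].
  apply: (cK _ F (fun D y => exists2 x, x \in D & P x y)) => x Kx.
  exists (P x, [set D : seq X | x \in D]) => /=.
    by split; [exact: KP|exists [:: x] => // D; apply; rewrite inE].
  by move=> [y D] [/= Pxy xD]; exists x.
by have [D KD] := @filter_ex _ F FF _ KF; exists D => y /KD.
Qed.

Section Fibre.
Context {R : realType} {X : topologicalType} {C : C0Category R X}.
Implicit Types (r s u : C) (f g h : C0 R X) (p q : X -> R) (x y : X).

Lemma fibre_norms_has_inf r s x (t : arrow r s) :
  has_inf [set rnorm u | u in [set u | fibre_map x u = fibre_map x t]].
Proof. by split; [exists (rnorm t), t|exists 0 => _ [u _ <-]; exact: rnorm_ge0]. Qed.

Lemma rnorm_fibre_map r s x (t : arrow r s) : rnorm (fibre_map x t) =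
  inf [set rnorm u | u in [set u | fibre_map x u = fibre_map x t]].
Proof. by []. Qed.

Lemma fibre_map_le r s x (t : arrow r s) : rnorm (fibre_map x t) <= rnorm t.
Proof.
by rewrite rnorm_fibre_map; apply: ge_inf; [case: (fibre_norms_has_inf x t)|exists t].
Qed.

Lemma fibre_map_lift r s x (t : arrow r s) (c : R) : rnorm (fibre_map x t) < c ->
  exists2 u, fibre_map x u = fibre_map x t & rnorm u < c.
Proof.
rewrite rnorm_fibre_map => /inf_lt-/(_ (fibre_norms_has_inf x t).1)[_ [u ut <-] uc].
by exists u.
Qed.

Lemma fibre_mapB r s x (t u : arrow r s) :
  fibre_map x (t - u) = fibre_map x t - fibre_map x u.
Proof. exact: (linearB (@quotient_map R _ (fibre_kernel x r s))). Qed.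

Lemma fibre_mapZ r s x (k : R[i]) (t : arrow r s) :
  fibre_map x (k *: t) = k *: fibre_map x t.
Proof. exact: quotient_mapZ. Qed.

Lemma fibre_map_eq0 r s x (t : arrow r s) : fibre_map x t = 0 <->
  closure (linear_span [set C0_act f t | f in @C0_vanishing_at R X x & t in [set: arrow r s]]) t.
Proof. exact: quotient_map_eq0. Qed.

(** The constant [f x] need not lie in [C0 R X], so [f t - f(x) t] is approximated by
    [(f g - f(x) g) t] with [g t] close to [t]; this function vanishes at [x]. The error is at most
    [2 M |t - g t|]. *)
Lemma fibre_map_act r s x f (t : arrow r s) :
  fibre_map x (C0_act f t) = f x *: fibre_map x t.
Proof.
apply: subr0_eq; rewrite -fibre_mapZ -fibre_mapB; apply/fibre_map_eq0/rclosureP => e e0.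
have [M M0 fM] := C0_bounded f.
have [g [p [_ _ _ gt]]] := C0_approximate t (divr_gt0 e0 (mulr_gt0 (ltr0Sn _ 1) M0)).
exists (C0_act (C0_mul f g - f x *: g) t).
  exists 1%N, (fun=> 1), (fun=> C0_act (C0_mul f g - f x *: g) t); split=> [_|].
    by exists (C0_mul f g - f x *: g) => //=; [exact: (subrr (f x * g x))|exists t].
  by rewrite big_ord1 scale1r.
have -> : C0_act f t - f x *: t - C0_act (C0_mul f g - f x *: g) t =
    C0_act f (t - C0_act g t) - f x *: (t - C0_act g t).
  by rewrite C0_actBl C0_actM C0_actZl C0_actBr; lmodule.
rewrite (le_lt_trans (ler_rnormB _ _))// rnormZ.
have := C0_act_bound (t - C0_act g t) M0 fM.
have := fM x; have := rnorm_ge0 (t - C0_act g t); move: gt; rewrite ltr_pdivlMr ?mulr_gt0//.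
nra.
Qed.

Lemma C0_bump (hX : hausdorff_space X) (lcX : locally_compact [set: X]) x (U : set X) :
  nbhs x U -> exists h q, [/\ forall y, h y = (q y)%:C, forall y, 0 <= q y <= 1,
    \forall y \near x, q y = 1 & forall y, ~ U y -> q y = 0].
Proof.
move=> xU; have [K xK [cK _]] := lcX x I.
rewrite withinET in xK.
pose B := ~` (U `&` K)°.
have cB : closed B by rewrite closedC; exact: open_interior.
have nBx : ~ B x by move=> /(_ _)[]; exact: filterI.
have sep : uniform_separator [set x] B.
  exact: (@locally_compact_completely_regular X R lcX hX).
pose w : X -> R := Urysohn [set x] B.
have cw : continuous w by exact: Urysohn_continuous.
have w01 y : 0 <= w y <= 1.
  by have := @Urysohn_range X R [set x] B (w y); rewrite set_itvE/=; apply; exists y.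
have wx : w x = 0 by apply: (Urysohn_sub0 sep); exists x.
have wB y : B y -> w y = 1 by move=> By; apply: (Urysohn_sub1 sep); exists y.
(* [w] is only known to be 0 at [x] itself; doubling and truncating makes [q] equal to 1 wherever
   [w <= 1/2], hence near [x]. *)
pose q := (fun=> 1) \min (fun y => 2 * (1 - w y)).
have q01 y : 0 <= q y <= 1.
  by rewrite /q/= le_min ler01 ge_min lexx mulr_ge0// subr_ge0; case/andP: (w01 y).
have qB y : B y -> q y = 0 by move=> /wB; rewrite /q/= => ->; rewrite subrr mulr0 min_r.
have [h hq] : exists h : C0 R X, forall y, h y = (q y)%:C.
  apply: C0_of_real => [y|e e0]; last first.
    exists K => // y nK; rewrite qB ?normr0// => -/interior_subset[_].
    exact: nK.
  apply: continuous_min; first exact: cvg_cst.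
  apply: cvgM; first exact: cvg_cst.
  by apply: cvgB; [exact: cvg_cst|exact: cw].
exists h, q; split=> // [|y nU]; last by apply: qB => /interior_subset[].
have half0 : 0 < 2^-1 :> R by [].
have /cvgrPdist_lt/(_ _ half0) := cw x; rewrite wx; apply: filterS => y.
by rewrite sub0r normrN ltr_norml /q/= => /andP[_ wy]; rewrite min_l//; lra.
Qed.

(** Choose [u] in the class of [t] with [|u| < c], and [v = sum_i k_i f_i b_i] close to [t - u] with
    every [f_i] vanishing at [x]. Then [|t - v| < c], and a bump [h] supported where all [f_i] are
    small makes [h v] negligible. *)
Lemma C0_localize (hX : hausdorff_space X) (lcX : locally_compact [set: X])
    r s (t : arrow r s) x (c : R) : rnorm (fibre_map x t) < c ->
  exists h q, [/\ forall y, h y = (q y)%:C, forall y, 0 <= q y <= 1,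
    \forall y \near x, q y = 1 & rnorm (C0_act h t) < c].
Proof.
move=> /fibre_map_lift[u ut uc].
have : fibre_map x (t - u) = 0 by rewrite fibre_mapB ut subrr.
have uc0 : 0 < c - rnorm u by rewrite subr_gt0.
move=> /fibre_map_eq0/rclosureP/(_ _ uc0)[v /linear_span_image2[n [k [f [b [fx vE]]]]] tuv].
have tvc : 0 < c - rnorm (t - v).
  have := ler_rnormD (t - u - v) u; rewrite addrAC addrNK; lra.
set d := (c - rnorm (t - v)) / (\sum_i rnorm (k i) * rnorm (b i) + 1).
have d0 : 0 < d.
  by rewrite divr_gt0// ltr_wpDl// sumr_ge0// => i _; rewrite mulr_ge0 ?rnorm_ge0.
have xU : \forall y \near x, forall i, rnorm (f i y) < d.
  apply: filter_forall => i; apply: filterS (C0_near (f i) x d0) => y.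
  by rewrite (fx i) sub0r rnormN.
have [h [q [hq q01 q1 q0]]] := C0_bump hX lcX xU.
exists h, q; split=> //.
have hv : C0_act h v = \sum_i k i *: C0_act (C0_mul h (f i)) (b i).
  by rewrite vE C0_act_sumr; apply: eq_bigr => i _; rewrite C0_actZr C0_actM.
have hf i y : rnorm (C0_mul h (f i) y) <= d.
  rewrite [X in rnorm X](_ : _ = (q y)%:C *: f i y); last by rewrite -hq.
  have /andP[qy0 qy1] := q01 y; rewrite rnormZr ger0_norm//.
  have [fy|/q0->] := pselect (forall j, rnorm (f j y) < d); last by rewrite mul0r ltW.
  have := fy i; have := rnorm_ge0 (f i y); nra.
have := C0_act_sum_bound tvc erefl hf; rewrite -hv.
have : rnorm (C0_act h (t - v)) <= rnorm (t - v).
  apply: C0_act_contraction => y; rewrite hq rnormC.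
  by have /andP[qy0 qy1] := q01 y; rewrite ger0_norm.
have := ler_rnormD (C0_act h (t - v)) (C0_act h v).
by rewrite -C0_actDr subrK; lra.
Qed.

End Fibre.

(** * Upper semicontinuity, decay at infinity and the supremum formula *)

Theorem proposition2p6 (R : realType) (X : topologicalType)
    (hX : hausdorff_space X) (lcX : locally_compact [set: X])
    (C : C0Category R X) (r s : C) (t : arrow r s) :
  let n_t : X -> R := fun x => rnorm (fibre_map x t) in
  [/\ upper_semicontinuous n_t,
      vanishes_at_infinity n_t &
      rnorm t = sup (range n_t)].
Proof.
move=> n_t; have nle x : n_t x <= rnorm t by exact: fibre_map_le.
have n0 x : 0 <= n_t x by exact: rnorm_ge0.
split=> [x a xa|e e0|].
- have [h [q [hq _ q1 ha]]] := C0_localize hX lcX xa.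
  (* Where [q y = 1] the arrows [t] and [h t] have the same image in the fibre at [y]. *)
  apply: filterS q1 => y qy; apply: le_lt_trans ha.
  rewrite /n_t; apply: le_trans (fibre_map_le y (C0_act h t)).
  by rewrite fibre_map_act hq qy scale1r.
- have [g [p [gp _ [K cK pK] gt]]] := C0_approximate t e0.
  exists K => // x /pK px; rewrite ger0_norm//; apply: le_lt_trans gt.
  apply: le_trans (fibre_map_le x (t - C0_act g t)).
  by rewrite fibre_mapB fibre_map_act gp px scale0r subr0.
have nub : has_ubound (range n_t) by exists (rnorm t) => _ [x _ <-].
have nsup x : n_t x <= sup (range n_t) by apply: ub_le_sup => //; exists x.
have [sup_ge0 supt] : 0 <= sup (range n_t) /\ sup (range n_t) <= rnorm t.
  have [[x _]|X0] := pselect (exists x : X, True).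
    split; first exact: le_trans (n0 x) (nsup x).
    by apply: ge_sup; [exists (n_t x), x|move=> _ [y _ <-]].
  (* For empty [X] the supremum takes its default value 0. *)
  have -> : range n_t = set0 by rewrite -subset0 => y [x _ _]; apply: X0; exists x.
  by rewrite sup0 rnorm_ge0.
apply/le_anti/andP; split=> //.
apply/ler_addgt0Pr => e e0; have e2 : 0 < e / 2 by rewrite divr_gt0.
have [g [p [gp p01 [K cK pK] gt]]] := C0_approximate t e2.
(* The margin [e / 2] makes the bound strict at every point, as [C0_localize] demands. *)
have /boolp.choice[h hP] : forall x : X, exists hq : C0 R X * (X -> R),
    [/\ forall y, hq.1 y = (hq.2 y)%:C, forall y, 0 <= hq.2 y <= 1,
    \forall y \near x, hq.2 y = 1 & rnorm (C0_act hq.1 t) < sup (range n_t) + e / 2].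
  move=> x; have [|h [q ?]] := @C0_localize _ _ _ hX lcX _ _ t x (sup (range n_t) + e / 2).
    by rewrite (le_lt_trans (nsup x))// ltrDl.
  by exists (h, q).
have [D KD] : exists D : seq X, forall y, K y -> exists2 x, x \in D & (h x).2 y = 1.
  by apply: compact_finite_cover => // x _; have [] := hP x.
have tg : rnorm (C0_act g t) <= sup (range n_t) + e / 2.
  (* A point where [p] is nonzero lies in [K], so some bump of the finite family equals 1 there and
     dominates [p <= 1]. *)
  apply: (@C0_act_cover _ _ _ _ _ g p _ D (fun x => (h x).1) (fun x => (h x).2)) => //.
  - by move=> x; case/andP: (p01 x).
  - by move=> x; have [] := hP x.
  - by move=> x y; have [_ /(_ y)/andP[]] := hP x.
  - move=> y py; have [|x Dx xy] := KD y.
      by apply: contrapT => /pK/eqP; rewrite (negbTE py).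
    by exists x; rewrite // xy; case/andP: (p01 y).
  - by rewrite ltr_wpDl.
  - by move=> x _; have [_ _ _ /ltW] := hP x.
have := ler_rnorm_sub t (C0_act g t); lra.
Qed.
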